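(* For an integer $d\ge 2$ and a field $\mathbb{K}$, let $H_L(\mathbb{K},d)$ be the minimum of $H_L(\mathbb{K},\mathcal{L})$ over all configurations $\mathcal{L}$ of $d$ lines in $\mathbb{P}^2(\mathbb{K})$, and let $H_L(d)=\min_{\mathbb{K}} H_L(\mathbb{K},d)$, the minimum over all fields $\mathbb{K}$. Then the absolute linear Harbourne constants are $$H_L(2)=0,\ H_L(3)=-1,\ H_L(4)=-\tfrac{4}{3},\ H_L(5)=-\tfrac{3}{2},\ H_L(6)=-\tfrac{12}{7},\ H_L(7)=-2,\ H_L(8)=-2,\ H_L(9)=-\tfrac{9}{4},\ H_L(10)=-\tfrac{29}{12},$$ and over the complex numbers $$H_L(\mathbb{C},2)=0,\ H_L(\mathbb{C},3)=-1,\ H_L(\mathbb{C},4)=-\tfrac{4}{3},\ H_L(\mathbb{C},5)=-\tfrac{3}{2},\ H_L(\mathbb{C},6)=-\tfrac{12}{7},\ H_L(\mathbb{C},7)=-\tfrac{17}{9},\ H_L(\mathbb{C},8)=-2,\ H_L(\mathbb{C},9)=-\tfrac{9}{4},\ H_L(\mathbb{C},10)=-\tfrac{34}{15}.$$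
   Context: A configuration of lines in $\mathbb{P}^2(\mathbb{K})$ is a family $\mathcal{L}=\{L_1,\ldots,L_d\}$ of $d$ mutually distinct lines. Its set of singular points $\mathcal{P}(\mathcal{L})=\{P_1,\ldots,P_s\}$ is the set of points lying on at least two lines of $\mathcal{L}$. For a point $P$, $m_{\mathcal{L}}(P)$ denotes the number of lines of $\mathcal{L}$ passing through $P$. The linear Harbourne constant of $\mathcal{L}$ is $$H_L(\mathbb{K},\mathcal{L})=\frac{d^2-\sum_{k=1}^s m_{\mathcal{L}}(P_k)^2}{s}.$$ *)

(* Defs.v *)
(* Lines and points of P^2(K) are represented by nonzero
   vectors of K^3 (row vectors), up to nonzero scalars. *)
From HB Require Import structures.
From mathcomp Require Import all_boot all_order all_algebra.
From mathcomp Require Import complex.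
From mathcomp Require Import Rstruct.
Set Implicit Arguments. Unset Strict Implicit. Unset Printing Implicit Defensive.
Import Order.TTheory GRing.Theory Num.Theory.
Local Open Scope ring_scope.

Definition proj_eq (K : fieldType) (u v : 'rV[K]_3) : Prop :=
  exists c : K, c != 0 /\ u = c *: v.

Definition incident (K : fieldType) (l p : 'rV[K]_3) : bool :=
  \sum_(i < 3) l ord0 i * p ord0 i == 0.

Definition line_config (K : fieldType) (d : nat) (L : 'I_d -> 'rV[K]_3) : Prop :=
  (forall i, L i != 0) /\ (forall i j, i != j -> ~ proj_eq (L i) (L j)).

Definition mult (K : fieldType) (d : nat) (L : 'I_d -> 'rV[K]_3) (p : 'rV[K]_3) : nat :=
  #|[set i : 'I_d | incident (L i) p]|.

Definition singular_points_enum (K : fieldType) (d : nat) (L : 'I_d -> 'rV[K]_3)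
    (ps : seq 'rV[K]_3) : Prop :=
  [/\ forall q, q \in ps -> q != 0,
      forall i j, (i < j < size ps)%N -> ~ proj_eq (nth 0 ps i) (nth 0 ps j),
      forall q, q \in ps -> (2 <= mult L q)%N &
      forall p, p != 0 -> (2 <= mult L p)%N -> exists2 q, q \in ps & proj_eq p q].

Definition is_HL (K : fieldType) (d : nat) (L : 'I_d -> 'rV[K]_3) (h : rat) : Prop :=
  exists ps : seq 'rV[K]_3, singular_points_enum L ps /\
    h = ((d%:R : rat) ^+ 2 - \sum_(q <- ps) ((mult L q)%:R : rat) ^+ 2) / (size ps)%:R.

Definition HL_field (K : fieldType) (d : nat) (v : rat) : Prop :=
  (exists L : 'I_d -> 'rV[K]_3, line_config L /\ is_HL L v) /\
  (forall (L : 'I_d -> 'rV[K]_3) (h : rat), line_config L -> is_HL L h -> v <= h).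

Definition HL_abs (d : nat) (v : rat) : Prop :=
  (exists (K : fieldType) (L : 'I_d -> 'rV[K]_3), line_config L /\ is_HL L v) /\
  (forall (K : fieldType) (L : 'I_d -> 'rV[K]_3) (h : rat),
      line_config L -> is_HL L h -> v <= h).

Definition Cfield : fieldType := (Rdefinitions.R)[i].

(* Main.v *)
Require Import Defs.
From HB Require Import structures.
From mathcomp Require Import all_boot all_order all_algebra.
From mathcomp Require Import complex Rstruct ring lra zify.
Set Implicit Arguments. Unset Strict Implicit. Unset Printing Implicit Defensive.
Import Order.TTheory GRing.Theory Num.Theory.
Local Open Scope ring_scope.

(* Since every two lines meet in exactly one singular point, the multiplicities
   satisfy sum m (m - 1) = d (d - 1), so the Harbourne constant is (d - I) / s, where
   I is the number of incidences.  A bound H >= - a / b is therefore the linear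
   inequality b I <= b d + a s on the numbers t_m of points of multiplicity m.

   If some point P has large multiplicity m, the inequality follows by charging every
   other point Q to the pairs of lines through Q that avoid P: there are only
   C(d - m, 2) such pairs.  If all multiplicities are small, count the triple and
   quadruple points on each line, using that two points share at most one line.

   This leaves three combinatorial types, each confined to one characteristic:
   seven lines with seven triple points (the Fano plane, characteristic 2), and ten
   lines with either t_4 = 3, t_3 >= 8, where the quadruple points lie on one line,
   or t_4 = 4, t_3 = 6, where they form a complete quadrangle (characteristic 3). *)

(** * Vectors and incidence *)

(** Read [T] as the set of lines and each block [B k] as the lines through one singular point: a
    linear space is what remains of a configuration without its coordinates. Bounds at this level
    hold over every field at once, so for d other than 7 and 10 one complex configuration settles
    both minima. For d = 7 and d = 10 the absolute minimum is reached over F_2 and F_3 by types that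
    exist combinatorially, and only coordinates can exclude them over the complex numbers. On the
    existence side the obstacle is that complex numbers do not compute. The extremal configurations
    have coordinates in Z[w], w a cube root of unity, where vanishing is decided on pairs of
    integers; the rest is evaluation of a boolean incidence table. *)

Section Vectors.
Variable K : fieldType.
Implicit Types (u v w p q : 'rV[K]_3).

Lemma incidentE u v : incident u v =
  (u 0 0 * v 0 0 + u 0 1 * v 0 1 + u 0 2%:R * v 0 2%:R == 0).
Proof.
rewrite /incident 3!big_ord_recl big_ord0 addr0 addrA.
by congr (_ * _ + _ * _ + _ * _ == 0); congr (_ _ _); apply/val_inj.
Qed.

Lemma row3P u v :
  u 0 0 = v 0 0 -> u 0 1 = v 0 1 -> u 0 2%:R = v 0 2%:R -> u = v.
Proof.
move=> e0 e1 e2; apply/rowP => -[[|[|[|]]] //= lt3].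
- by move: e0; congr (_ = _); congr (_ _ _); apply/val_inj.
- by move: e1; congr (_ = _); congr (_ _ _); apply/val_inj.
- by move: e2; congr (_ = _); congr (_ _ _); apply/val_inj.
Qed.

Definition cross u v : 'rV[K]_3 :=
  \row_(j < 3) nth 0 [:: u 0 1 * v 0 2%:R - u 0 2%:R * v 0 1;
                         u 0 2%:R * v 0 0 - u 0 0 * v 0 2%:R;
                         u 0 0 * v 0 1 - u 0 1 * v 0 0] j.

Lemma cross_eq0 u v : u != 0 -> v != 0 -> cross u v = 0 -> proj_eq u v.
Proof.
move=> u0 v0 /rowP uv.
have := uv 0; have := uv 1; have := uv 2%:R.
rewrite !mxE /= => /subr0_eq e01 /subr0_eq e20 /subr0_eq e12.
have [c uc] : exists c, u = c *: v.
  have [v00|v00] := eqVneq (v 0 0) 0; last first.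
    exists (u 0 0 / v 0 0); apply/row3P; rewrite !mxE.
    - by rewrite divfK.
    - by rewrite mulrAC e01 mulfK.
    - by rewrite mulrAC -e20 mulfK.
  have [v01|v01] := eqVneq (v 0 1) 0; last first.
    exists (u 0 1 / v 0 1); apply/row3P; rewrite !mxE.
    - by rewrite mulrAC -e01 mulfK.
    - by rewrite divfK.
    - by rewrite mulrAC e12 mulfK.
  have [v02|v02] := eqVneq (v 0 2%:R) 0; last first.
    exists (u 0 2%:R / v 0 2%:R); apply/row3P; rewrite !mxE.
    - by rewrite mulrAC e20 mulfK.
    - by rewrite mulrAC -e12 mulfK.
    - by rewrite divfK.
  by case/eqP: v0; apply/row3P; rewrite !mxE.
exists c; split=> //; apply: contraNneq u0 => c0.
by rewrite uc c0 scale0r.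
Qed.

Lemma proj_eq_sym u v : proj_eq u v -> proj_eq v u.
Proof.
move=> [c [c0 ->]]; exists c^-1; rewrite invr_eq0 c0; split=> //.
by rewrite scalerA mulVf // scale1r.
Qed.

Lemma incident_proj u p q : proj_eq p q -> incident u p = incident u q.
Proof.
move=> [c [c0 ->]]; rewrite !incidentE !mxE.
rewrite -[RHS]orFb -(negPf c0) -mulf_eq0; congr (_ == 0); ring.
Qed.

Lemma incident_projl u v p : proj_eq u v -> incident u p = incident v p.
Proof.
move=> [c [c0 ->]]; rewrite !incidentE !mxE.
rewrite -[RHS]orFb -(negPf c0) -mulf_eq0; congr (_ == 0); ring.
Qed.

Lemma incident_cross u v w : incident w (cross u v) =
  (w 0 0 * (u 0 1 * v 0 2%:R - u 0 2%:R * v 0 1)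
   + w 0 1 * (u 0 2%:R * v 0 0 - u 0 0 * v 0 2%:R)
   + w 0 2%:R * (u 0 0 * v 0 1 - u 0 1 * v 0 0) == 0).
Proof. by rewrite incidentE !mxE. Qed.

(** The triple product p x (u x v) equals (v.p) u - (u.p) v, and both coefficients vanish here. *)
Lemma incident_both u v p : cross u v != 0 -> p != 0 ->
  incident u p -> incident v p -> proj_eq p (cross u v).
Proof.
rewrite !incidentE => uv p0 /eqP up /eqP vp; apply: cross_eq0 => //.
have triple i : u 0 i * (v 0 0 * p 0 0 + v 0 1 * p 0 1 + v 0 2%:R * p 0 2%:R)
    - v 0 i * (u 0 0 * p 0 0 + u 0 1 * p 0 1 + u 0 2%:R * p 0 2%:R) = 0.
  by rewrite up vp !mulr0 subr0.
apply/row3P; rewrite !mxE /=.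
- by rewrite -[RHS](triple 0); ring.
- by rewrite -[RHS](triple 1); ring.
- by rewrite -[RHS](triple 2%:R); ring.
Qed.

End Vectors.

(** * Certified realizations *)

Definition row3 (K : fieldType) (t : K * K * K) : 'rV[K]_3 :=
  \row_(j < 3) nth 0 [:: t.1.1; t.1.2; t.2] j.

Definition dot (R : pzRingType) (t u : R * R * R) : R :=
  t.1.1 * u.1.1 + t.1.2 * u.1.2 + t.2 * u.2.

Lemma incident_row3 (K : fieldType) (t u : K * K * K) :
  incident (row3 t) (row3 u) = (dot t u == 0).
Proof. by rewrite incidentE !mxE. Qed.

(* Lines and points are given with some extra ones (indices at least [d],
   resp. [s]), whose only role is to tell apart proportional vectors. *)
Definition certified (N M d s : nat) (tab : seq (seq bool)) : bool :=
  let inc i k := nth false (nth [::] tab i) k in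
  all (fun k => [&& has (fun i => ~~ inc i k) (iota 0 N),
                    (1 < count (inc^~ k) (iota 0 d))%N &
                    all (fun k' => (k' == k) ||
                      has (fun i => inc i k != inc i k') (iota 0 N)) (iota 0 s)])
    (iota 0 s) &&
  all (fun i => has (fun k => ~~ inc i k) (iota 0 M) &&
                all (fun j => (j == i) ||
                  has (fun k => inc i k != inc j k) (iota 0 M) &&
                  has (fun k => inc i k && inc j k) (iota 0 s)) (iota 0 d))
    (iota 0 d).

Definition squares_sum (d s : nat) (tab : seq (seq bool)) : nat :=
  let inc i k := nth false (nth [::] tab i) k in
  sumn [seq (count (inc^~ k) (iota 0 d) ^ 2)%N | k <- iota 0 s].

Lemma row3_neq0 (K : fieldType) (u p : 'rV[K]_3) : ~~ incident u p -> u != 0 /\ p != 0.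
Proof.
by rewrite incidentE => nz; split; apply: contraNneq nz => ->;
  rewrite !mxE ?mul0r ?mulr0 !addr0.
Qed.

(** Incidence is invariant under scaling, so one entry in which two rows or columns differ proves
    two vectors non-proportional, and one non-incidence proves both vectors nonzero. The list of
    points is complete because any two of the [d] lines share a listed point, and two distinct lines
    determine their common point. *)
Lemma certified_is_HL (K : fieldType) (N M d s : nat) (ls ps : nat -> 'rV[K]_3)
    (tab : seq (seq bool)) : (d <= N)%N -> (s <= M)%N ->
  (forall i k, (i < N)%N -> (k < M)%N -> incident (ls i) (ps k) =
    nth false (nth [::] tab i) k) ->
  certified N M d s tab ->
  line_config (fun i : 'I_d => ls i) /\
  is_HL (fun i : 'I_d => ls i) (((d ^ 2)%:R - (squares_sum d s tab)%:R) / s%:R).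
Proof.
set inc := fun i k => nth false (nth [::] tab i) k.
move=> dN sM incE /andP[/allP ptsP /allP linesP].
have multE k : (k < s)%N ->
    mult (fun i : 'I_d => ls i) (ps k) = count (inc^~ k) (iota 0 d).
  move=> ks; rewrite /mult -sum1dep_card -(big_mkord (fun i =>
    incident (ls i) (ps k)) (fun=> 1%N)).
  rewrite -sum1_count /index_iota subn0 big_seq_cond [RHS]big_seq_cond.
  apply: eq_bigl => i; rewrite mem_iota add0n /=.
  case: ltnP => //= id; rewrite incE //; [exact: leq_trans id dN|exact: leq_trans ks sM].
have pts k : (k < s)%N -> ps k != 0.
  move=> ks; have /and3P[/hasP[i + ik] _ _] := ptsP k ltac:(by rewrite mem_iota).
  rewrite mem_iota add0n => iN; rewrite -incE ?(leq_trans ks) // in ik.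
  by case/row3_neq0: ik.
have linesN i : (i < d)%N -> ls i != 0.
  move=> id; have /andP[/hasP[k + ik] _] := linesP i ltac:(by rewrite mem_iota).
  rewrite mem_iota add0n => kM; rewrite -incE ?(leq_trans id) // in ik.
  by case/row3_neq0: ik.
have lines i j : (i < d)%N -> (j < d)%N -> i != j ->
    ~ proj_eq (ls i) (ls j) /\
    exists2 k, (k < s)%N & incident (ls i) (ps k) && incident (ls j) (ps k).
  move=> id jd ij; have /andP[_ /allP/(_ j)] := linesP i ltac:(by rewrite mem_iota).
  rewrite mem_iota add0n jd eq_sym (negPf ij) =>
    /(_ isT)/andP[/hasP[k + neq] /hasP[k' + inc2]].
  rewrite !mem_iota !add0n => kM k's.
  rewrite -!incE ?(leq_trans id) ?(leq_trans jd) ?(leq_trans k's) // in neq inc2.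
  split; last by exists k'.
  by move=> /(incident_projl (ps k)) e; rewrite e eqxx in neq.
split.
  split=> [i|i j ij]; first exact: linesN.
  by have [] := lines i j (ltn_ord i) (ltn_ord j) ij.
exists (mkseq ps s); split; last first.
  rewrite size_mkseq big_map natrX; congr ((_ - _) / _).
  rewrite /squares_sum sumnE big_map natr_sum big_seq [RHS]big_seq.
  by apply: eq_bigr => k; rewrite mem_iota add0n => /andP[_ ks]; rewrite multE // natrX.
split=> [q /mapP[k]|k k'|q /mapP[k]|p p0].
- by rewrite mem_iota add0n => ks ->; apply: pts.
- rewrite size_mkseq => /andP[kk' k's]; have ks := ltn_trans kk' k's.
  rewrite !nth_mkseq //; have /and3P[_ _ /allP/(_ k')] := ptsP k ltac:(by rewrite mem_iota).
  rewrite mem_iota add0n k's gtn_eqF // => /(_ isT)/hasP[i + neq].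
  rewrite mem_iota add0n => iN.
  rewrite -!incE ?(leq_trans ks) ?(leq_trans k's) // in neq.
  by move=> /(incident_proj (ls i)) e; rewrite e eqxx in neq.
- rewrite mem_iota add0n => ks ->; rewrite multE //.
  by have /and3P[] := ptsP k ltac:(by rewrite mem_iota).
case/card_gt1P => i [j]; rewrite !inE => -[ip jp ij].
have [neq [k ks /andP[ik jk]]] := lines i j (ltn_ord i) (ltn_ord j) ij.
exists (ps k); first by apply/mapP; exists k; rewrite ?mem_iota.
have cross0 : cross (ls i) (ls j) != 0.
  by apply/eqP => /(cross_eq0 (linesN i (ltn_ord i)) (linesN j (ltn_ord j))).
have [c [c0 ->]] := incident_both cross0 p0 ip jp.
have [c' [c'0 ->]] := incident_both cross0 (pts k ks) ik jk.
exists (c / c'); rewrite mulf_neq0 ?invr_eq0 //; split=> //.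
by rewrite scalerA divfK.
Qed.

Definition table (S : Type) (van : S -> S -> bool) (ls ps : seq S) : seq (seq bool) :=
  [seq [seq van l p | p <- ps] | l <- ls].

(** The field [K] may not compute, so the table is built from codes in [S], on which [van] decides
    incidence by evaluation. *)
Lemma realization (K : fieldType) (S : Type) (vec : S -> 'rV[K]_3) (van : S -> S -> bool)
    (ls ps : seq S) (d s : nat) (v : rat) :
  (forall l p, incident (vec l) (vec p) = van l p) ->
  [&& (0 < d)%N, (0 < s)%N, (d <= size ls)%N & (s <= size ps)%N] ->
  certified (size ls) (size ps) d s (table van ls ps) ->
  v = ((d ^ 2)%:R - (squares_sum d s (table van ls ps))%:R) / s%:R ->
  exists L : 'I_d -> 'rV[K]_3, line_config L /\ is_HL L v.
Proof.
case: ls ps => [|l0 ls] [|p0 ps] vanP /and4P[d0 s0 dN sM]; rewrite ?leqn0 in dN sM.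
- by rewrite (eqP dN) in d0.
- by rewrite (eqP dN) in d0.
- by rewrite (eqP sM) in s0.
move=> cert ->; eexists.
apply: (certified_is_HL (ls := fun i => vec (nth l0 (l0 :: ls) i))
          (ps := fun k => vec (nth p0 (p0 :: ps) k)) dN sM _ cert) => i k iN kM.
by rewrite vanP /table (nth_map l0) // (nth_map p0).
Qed.

(* [(a, b)] stands for a + b w, where w is a primitive cube root of unity. *)
Definition eis : Type := (int * int)%type.

Definition eis_add (x y : eis) : eis := (x.1 + y.1, x.2 + y.2).

Definition eis_mul (x y : eis) : eis :=
  (x.1 * y.1 - x.2 * y.2, x.1 * y.2 + x.2 * y.1 - x.2 * y.2).

Definition eis_dot (t u : eis * eis * eis) : eis :=
  eis_add (eis_add (eis_mul t.1.1 u.1.1) (eis_mul t.1.2 u.1.2)) (eis_mul t.2 u.2).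

Section Eisenstein.
Variables (F : numFieldType) (w : F).
Hypothesis w_root : w ^+ 2 + w + 1 = 0.

Definition eis_val (x : eis) : F := x.1%:~R + x.2%:~R * w.

Lemma eis_valD x y : eis_val (eis_add x y) = eis_val x + eis_val y.
Proof. by rewrite /eis_val /= !rmorphD /=; ring. Qed.

Lemma eis_valM x y : eis_val (eis_mul x y) = eis_val x * eis_val y.
Proof.
have w2 : w * w = - w - 1 by rewrite -[LHS]addr0 -oppr0 -w_root; ring.
rewrite /eis_val /= !(rmorphD, rmorphB, rmorphM) /=.
transitivity (x.1%:~R * y.1%:~R + (x.1%:~R * y.2%:~R + x.2%:~R * y.1%:~R) * w
              + x.2%:~R * y.2%:~R * (w * w)); last by ring.
by rewrite w2; ring.
Qed.

(** Multiplying a + b w by its conjugate a - b - b w gives the norm a^2 - a b + b^2, a definite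
    integral form; characteristic 0 brings its vanishing back to the integers. *)
Lemma eis_val_eq0 x : (eis_val x == 0) = (x == (0, 0)).
Proof.
case: x => a b; rewrite xpair_eqE /eis_val /=; apply/idP/idP; last first.
  by case/andP => /eqP-> /eqP->; rewrite mul0r addr0.
move/eqP => ab0; have: ((a * a - a * b + b * b)%:~R : F) = 0.
  rewrite !(rmorphD, rmorphB, rmorphM) /=.
  have w2 : w * w = - w - 1 by rewrite -[LHS]addr0 -oppr0 -w_root; ring.
  transitivity ((a%:~R + b%:~R * w) * (a%:~R - b%:~R - b%:~R * w)
                + b%:~R ^+ 2 * (w ^+ 2 + w + 1)); first by ring.
  by rewrite ab0 w_root mul0r mulr0 addr0.
move/eqP; rewrite intr_eq0 => /eqP; nia.
Qed.

Lemma incident_eis (t u : eis * eis * eis) :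
  incident (row3 (eis_val t.1.1, eis_val t.1.2, eis_val t.2))
           (row3 (eis_val u.1.1, eis_val u.1.2, eis_val u.2)) = (eis_dot t u == (0, 0)).
Proof. by rewrite incident_row3 /dot /= -eis_val_eq0 !eis_valD !eis_valM. Qed.

End Eisenstein.

Definition eis_vec (F : numFieldType) (w : F) (t : eis * eis * eis) : 'rV[F]_3 :=
  row3 (eis_val w t.1.1, eis_val w t.1.2, eis_val w t.2).

Definition eis_vanish (t u : eis * eis * eis) : bool := eis_dot t u == (0, 0).

Lemma eis_realization (ls ps : seq (eis * eis * eis)) (d s : nat) (v : rat) :
  [&& (0 < d)%N, (0 < s)%N, (d <= size ls)%N & (s <= size ps)%N] ->
  certified (size ls) (size ps) d s (table eis_vanish ls ps) ->
  v = ((d ^ 2)%:R - (squares_sum d s (table eis_vanish ls ps))%:R) / s%:R ->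
  exists L : 'I_d -> 'rV[Cfield]_3, line_config L /\ is_HL L v.
Proof.
pose C : numClosedFieldType := Rdefinitions.R[i].
have [w w_root] : exists w : C, w ^+ 2 + w + 1 = 0.
  exists ((sqrtC (- 3%:R) - 1) / 2%:R); set r := sqrtC _.
  have r2 : r ^+ 2 = - 3%:R by apply: sqrtCK.
  have n2 : (2%:R : C) != 0 by rewrite pnatr_eq0.
  apply: (mulfI (mulf_neq0 n2 n2)); rewrite mulr0 -[RHS](subrr (- 3%:R)) -[in RHS]r2 r2.
  transitivity (r ^+ 2 + 3%:R); first by field.
  by rewrite r2; ring.
exact: (@realization C _ (eis_vec w) _ ls ps d s v (incident_eis w_root)).
Qed.

(** * Explicit extremal configurations over C, F_2 and F_3 *)

Definition inte (a : int) : eis := (a, 0).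
Definition ivec (a b c : int) : eis * eis * eis := (inte a, inte b, inte c).

Definition omega : eis := (0, 1).
Definition omegaN : eis := (0, -1).
Definition omega2 : eis := (-1, -1).
Definition omega2N : eis := (1, 1).

Definition lines2 : seq (eis * eis * eis) := [:: ivec 1 0 0; ivec 0 1 0; ivec 0 0 1].

Definition points2 : seq (eis * eis * eis) := [:: ivec 0 0 1; ivec 0 1 0; ivec 1 0 0].

Lemma attained2 : exists L : 'I_2 -> 'rV[Cfield]_3, line_config L /\ is_HL L 0.
Proof.
by apply: (@eis_realization lines2 points2 2 1); [|vm_compute|apply/eqP; vm_compute].
Qed.

Lemma attained3 : exists L : 'I_3 -> 'rV[Cfield]_3, line_config L /\ is_HL L (-1).
Proof.
by apply: (@eis_realization lines2 points2 3 3); [|vm_compute|apply/eqP; vm_compute].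
Qed.

(** Four lines in general position, with six double points. *)
Definition lines4 : seq (eis * eis * eis) :=
  [:: ivec 1 0 0; ivec 0 1 0; ivec 0 0 1; ivec 1 1 1].

Definition points4 : seq (eis * eis * eis) :=
  [:: ivec 0 0 1; ivec 0 1 0; ivec 0 1 (- 1); ivec 1 0 0; ivec 1 0 (- 1);
      ivec 1 (- 1) 0].

Lemma attained4 : exists L : 'I_4 -> 'rV[Cfield]_3,
  line_config L /\ is_HL L (- (4%:R / 3%:R)).
Proof.
by apply: (@eis_realization lines4 points4 4 6); [|vm_compute|apply/eqP; vm_compute].
Qed.

Definition lines5 : seq (eis * eis * eis) :=
  [:: ivec 1 0 0; ivec 0 1 0; ivec 0 0 1; ivec 1 (- 1) 0; ivec 0 1 (- 1)].

Definition points5 : seq (eis * eis * eis) :=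
  [:: ivec 0 0 1; ivec 0 1 0; ivec 0 1 1; ivec 1 0 0; ivec 1 1 0; ivec 1 1 1].

Lemma attained5 : exists L : 'I_5 -> 'rV[Cfield]_3,
  line_config L /\ is_HL L (- (3%:R / 2%:R)).
Proof.
by apply: (@eis_realization lines5 points5 5 6); [|vm_compute|apply/eqP; vm_compute].
Qed.

(** The six sides of the complete quadrangle on the coordinate points and (1, 1, 1); [lines5] is
    this with one side removed. *)
Definition lines6 : seq (eis * eis * eis) :=
  [:: ivec 1 0 0; ivec 0 1 0; ivec 0 0 1; ivec 1 (- 1) 0; ivec 0 1 (- 1);
      ivec 1 0 (- 1)].

Definition points6 : seq (eis * eis * eis) :=
  [:: ivec 0 0 1; ivec 0 1 0; ivec 0 1 1; ivec 1 0 0; ivec 1 0 1; ivec 1 1 0;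
      ivec 1 1 1].

Lemma attained6 : exists L : 'I_6 -> 'rV[Cfield]_3,
  line_config L /\ is_HL L (- (12%:R / 7%:R)).
Proof.
by apply: (@eis_realization lines6 points6 6 7); [|vm_compute|apply/eqP; vm_compute].
Qed.

(** The Fano vectors read in characteristic 0: six triple points survive, and the seventh breaks
    into the three double points listed last. *)
Definition lines7 : seq (eis * eis * eis) :=
  [:: ivec 0 0 1; ivec 0 1 0; ivec 0 1 1; ivec 1 0 0; ivec 1 0 1; ivec 1 1 0;
      ivec 1 1 1].

Definition points7 : seq (eis * eis * eis) :=
  [:: ivec 1 0 0; ivec 0 1 0; ivec 1 (- 1) 0; ivec 0 0 1; ivec 1 0 (- 1);
      ivec 0 1 (- 1); ivec 1 1 (- 1); ivec 1 (- 1) 1; ivec 1 (- 1) (- 1)].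

Lemma attained7 : exists L : 'I_7 -> 'rV[Cfield]_3,
  line_config L /\ is_HL L (- (17%:R / 9%:R)).
Proof.
by apply: (@eis_realization lines7 points7 7 9); [|vm_compute|apply/eqP; vm_compute].
Qed.

(** The quadrilateral x + y + z, x + y - z, x - y + z, x - y - z, with the four lines that join its
    six vertices to the point (0, 0, 1) of its diagonal triangle. *)
Definition lines8 : seq (eis * eis * eis) :=
  [:: ivec 1 0 0; ivec 0 1 0; ivec 1 1 0; ivec 1 (- 1) 0; ivec 1 1 1; ivec 1 1 (- 1);
      ivec 1 (- 1) 1; ivec 1 (- 1) (- 1)].

Definition points8 : seq (eis * eis * eis) :=
  [:: ivec 0 0 1; ivec 0 1 (- 1); ivec 0 1 1; ivec 1 0 (- 1); ivec 1 0 1;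
      ivec 1 (- 1) 0; ivec 1 (- 1) (- 2); ivec 1 (- 1) 2; ivec 1 1 (- 2); ivec 1 1 2;
      ivec 1 1 0].

Lemma attained8 : exists L : 'I_8 -> 'rV[Cfield]_3,
  line_config L /\ is_HL L (- 2).
Proof.
by apply: (@eis_realization lines8 points8 8 11); [|vm_compute|apply/eqP; vm_compute].
Qed.

(** The dual Hesse configuration (x^3 - y^3)(y^3 - z^3)(z^3 - x^3) = 0, whose twelve singular points
    are all triple. *)
Definition lines9 : seq (eis * eis * eis) :=
  [:: ivec 1 (- 1) 0; (inte 1, omegaN, inte 0); (inte 1, omega2N, inte 0); ivec 0 1 (- 1);
      (inte 0, inte 1, omegaN); (inte 0, inte 1, omega2N); ivec (- 1) 0 1;
      (omegaN, inte 0, inte 1); (omega2N, inte 0, inte 1)].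

Definition points9 : seq (eis * eis * eis) :=
  [:: ivec 0 0 1; ivec 1 1 1; (inte 1, inte 1, omega2); (inte 1, inte 1, omega);
      (inte 1, omega2, omega2); (inte 1, omega2, omega); (inte 1, omega2, inte 1);
        (inte 1, omega, omega);
      (inte 1, omega, inte 1); (inte 1, omega, omega2); ivec 1 0 0; ivec 0 1 0].

Lemma attained9 : exists L : 'I_9 -> 'rV[Cfield]_3,
  line_config L /\ is_HL L (- (9%:R / 4%:R)).
Proof.
by apply: (@eis_realization lines9 points9 9 12); [|vm_compute|apply/eqP; vm_compute].
Qed.

(** Adding z = 0 to the dual Hesse configuration makes two triple points quadruple and creates three
    double points. *)
Definition lines10 : seq (eis * eis * eis) :=
  [:: ivec 1 (- 1) 0; (inte 1, omegaN, inte 0); (inte 1, omega2N, inte 0); ivec 0 1 (- 1);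
      (inte 0, inte 1, omegaN); (inte 0, inte 1, omega2N); ivec (- 1) 0 1;
      (omegaN, inte 0, inte 1); (omega2N, inte 0, inte 1); ivec 0 0 1].

Definition points10 : seq (eis * eis * eis) :=
  [:: ivec 0 0 1; ivec 1 1 1; (inte 1, inte 1, omega2); (inte 1, inte 1, omega); ivec 1 1 0;
      (inte 1, omega2, omega2); (inte 1, omega2, omega); (inte 1, omega2, inte 1);
      (inte 1, omega2, inte 0); (inte 1, omega, omega); (inte 1, omega, inte 1);
        (inte 1, omega, omega2);
      (inte 1, omega, inte 0); ivec 1 0 0; ivec 0 1 0].

Lemma attained10 : exists L : 'I_10 -> 'rV[Cfield]_3,
  line_config L /\ is_HL L (- (34%:R / 15%:R)).
Proof.
by apply: (@eis_realization lines10 points10 10 15); [|vm_compute|apply/eqP; vm_compute].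
Qed.

Definition linesF2 : seq ('F_2 * 'F_2 * 'F_2) :=
  [:: (0, 0, 1); (0, 1, 0); (0, 1, 1); (1, 0, 0); (1, 0, 1); (1, 1, 0); (1, 1, 1)].

Definition pointsF2 : seq ('F_2 * 'F_2 * 'F_2) :=
  [:: (0, 0, 1); (0, 1, 0); (0, 1, 1); (1, 0, 0); (1, 0, 1); (1, 1, 0); (1, 1, 1)].

(** The plane over F_3 without three of the four lines through (0, 0, 1). The fourth, y = 0, carries
    the three quadruple points; the other nine points become triple. *)
Definition linesF3 : seq ('F_3 * 'F_3 * 'F_3) :=
  [:: (0, 0, 1); (0, 1, 1); (0, 1, 2); (1, 0, 1);
      (1, 0, 2); (1, 1, 1); (1, 1, 2); (1, 2, 1); (1, 2, 2); (0, 1, 0)].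

Definition pointsF3 : seq ('F_3 * 'F_3 * 'F_3) :=
  [:: (0, 1, 0); (0, 1, 1); (0, 1, 2); (1, 0, 0); (1, 0, 1); (1, 0, 2);
      (1, 1, 0); (1, 1, 1); (1, 1, 2); (1, 2, 0); (1, 2, 1); (1, 2, 2)].

Lemma attained7_F2 : exists L : 'I_7 -> 'rV['F_2]_3, line_config L /\ is_HL L (- 2).
Proof.
by apply: (@realization _ _ (@row3 _) _ linesF2 pointsF2 7 7 _ (@incident_row3 _));
  [|vm_compute|apply/eqP; vm_compute].
Qed.

Lemma attained10_F3 : exists L : 'I_10 -> 'rV['F_3]_3,
  line_config L /\ is_HL L (- (29%:R / 12%:R)).
Proof.
by apply: (@realization _ _ (@row3 _) _ linesF3 pointsF3 10 12 _ (@incident_row3 _));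
  [|vm_compute|apply/eqP; vm_compute].
Qed.

(** * Counting in linear spaces *)

Lemma leq_sum_eq (J : finType) (P : pred J) (f g : J -> nat) :
  (forall i, P i -> (f i <= g i)%N) -> (\sum_(i | P i) g i <= \sum_(i | P i) f i)%N ->
  forall i, P i -> f i = g i.
Proof.
move=> fg gf i Pi; apply/eqP; rewrite eqn_leq fg //=.
rewrite -(leq_add2r (\sum_(j | P j && (j != i)) g j)%N).
rewrite -bigD1 //; apply: leq_trans gf _; rewrite (bigD1 i) //= leq_add2l.
by apply: leq_sum => j /andP[Pj _]; apply: fg.
Qed.

Section LinearSpace.
Local Open Scope nat_scope.
Variables (T I : finType) (B : I -> {set T}).

Definition linear_space : Prop :=
  [/\ forall k, 1 < #|B k|,
      forall i j, i != j -> exists2 k, i \in B k & j \in B k &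
      forall i j k l, i != j -> i \in B k -> j \in B k -> i \in B l -> j \in B l -> k = l].

Hypothesis lsB : linear_space.

Let sum_through (i j : T) : i != j -> \sum_(k | i \in B k) (j \in B k : nat) = 1.
Proof.
case: lsB => _ Bex Bun ij; have [k ik jk] := Bex i j ij.
rewrite (bigD1 k) //= jk big1 // => l /andP[il lk].
by apply/eqP; rewrite eqb0; apply: contra lk => jl; apply/eqP; apply: (Bun i j).
Qed.

(** Each element of [S] other than [i] lies with [i] in exactly one block, so the blocks through [i]
    partition them. A general [S] is allowed for the sake of the complement of a block in
    [pencil_pairs]. *)
Lemma degree_in (S : {set T}) (i : T) : i \in S ->
  \sum_(k | i \in B k) #|B k :&: S|.-1 = #|S|.-1.
Proof.
move=> iS; rewrite -[in RHS](setD1K iS) cardsU1 setD11 add1n /= -sum1_card.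
rewrite (eq_bigr (fun j => \sum_(k | i \in B k) (j \in B k : nat))); last first.
  by move=> j; rewrite !inE => /andP[ji _]; rewrite sum_through // eq_sym.
rewrite exchange_big /=; apply: eq_bigr => k ik.
rewrite (cardsD1 i) inE ik iS add1n /=.
rewrite -big_mkcondr -sum1_card; apply: eq_bigl => j; rewrite !inE; do 2 case: (_ \in _);
 by case: eqVneq.
Qed.

Lemma double_count (P : pred T) (F : I -> nat) :
  \sum_(i | P i) \sum_(k | i \in B k) F k = \sum_k #|[set i in B k | P i]| * F k.
Proof.
rewrite (exchange_big_dep xpredT) //=; apply: eq_bigr => k _.
by rewrite sum_nat_const -cardsE; congr (_ * _); apply: eq_card => i; rewrite !inE andbC.
Qed.

Lemma pairs_in (S : {set T}) :
  \sum_k #|B k :&: S| * #|B k :&: S|.-1 = #|S| * #|S|.-1.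
Proof.
rewrite -[RHS]sum_nat_const -(eq_bigr _ (@degree_in S)) double_count.
by apply: eq_bigr => k _; congr (_ * _); apply: eq_card => i; rewrite !inE.
Qed.

Lemma degree_sum (i : T) : \sum_(k | i \in B k) #|B k|.-1 = #|T|.-1.
Proof.
rewrite -[in RHS]cardsT -(@degree_in setT i (in_setT i)).
by apply: eq_bigr => k _; rewrite setIT.
Qed.

Lemma pairs_sum : \sum_k #|B k| * #|B k|.-1 = #|T| * #|T|.-1.
Proof.
rewrite -[in RHS]cardsT -pairs_in.
by apply: eq_bigr => k _; rewrite setIT.
Qed.

Lemma card_meet (k l : I) : k != l -> #|B k :&: B l| <= 1.
Proof.
case: lsB => _ _ Bun kl; rewrite leqNgt; apply: contra kl => /card_gt1P[i [j]].
by rewrite !inE => -[/andP[ik il] /andP[jk jl] ij]; apply/eqP; apply: (Bun i j).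
Qed.

(* A point on [m] lines meets, outside [B k0], at least all but one of the lines
   through any other point. *)
Lemma pencil_pairs (k0 : I) :
  \sum_(k | k != k0) #|B k|.-1 * #|B k|.-2 <=
    (#|T| - #|B k0|) * (#|T| - #|B k0|).-1.
Proof.
have <- : #|~: B k0| = #|T| - #|B k0| by rewrite cardsCs setCK.
rewrite -pairs_in [leqRHS](bigD1 k0) //= setICr cards0 add0n.
apply: leq_sum => k kk0.
have : #|B k|.-1 <= #|B k :&: ~: B k0|.
  by rewrite -(cardsID (B k0) (B k)) setDE; have := card_meet kk0; lia.
move: #|B k|.-1 #|_| => m j mj; apply: leq_mul => //; lia.
Qed.

(** The hypothesis is summed over all points but [k0]. The weights [c] and [c'] stand for one signed
    multiple of the identity [pairs_sum], and [C] weighs the ordered pairs of lines avoiding [k0].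
    In every use c - c' = 2 b - a and C = 2 a - 3 b, the choice that makes the hypothesis an
    equality at double and at triple points. *)
Lemma pencil_bound (b a c c' C : nat) (k0 : I) :
  (forall x, 1 < x ->
    2 * b * x + c' * (x * x.-1) <= 2 * a + c * (x * x.-1) + C * (x.-1 * x.-2)) ->
  2 * b * \sum_k #|B k| + 2 * a + c * (#|B k0| * #|B k0|.-1) + c' * (#|T| * #|T|.-1) <=
  2 * a * #|I| + c * (#|T| * #|T|.-1) + c' * (#|B k0| * #|B k0|.-1) + 2 * b * #|B k0|
  + C * ((#|T| - #|B k0|) * (#|T| - #|B k0|).-1).
Proof.
case: lsB => Bgt1 _ _ abc.
have le : \sum_(k | k != k0) (2 * b * #|B k| + c' * (#|B k| * #|B k|.-1)) <=
    \sum_(k | k != k0)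
    (2 * a * 1 + c * (#|B k| * #|B k|.-1) + C * (#|B k|.-1 * #|B k|.-2)).
  by apply: leq_sum => k _; rewrite muln1; apply: abc.
rewrite !big_split /= -!big_distrr /= in le.
have := pencil_pairs k0; rewrite -pairs_sum -[#|I|]sum1_card.
rewrite ![\sum_k _](bigD1 k0) //=.
move: le; move: (\sum_(k | k != k0) _) (\sum_(k | k != k0) _) (\sum_(k | k != k0) _)
  (\sum_(k | k != k0) _) => s1 s2 s3 s4; nia.
Qed.

(** Here c = 2 b - a gives equality at double points; in each use also c (d - 1) = 2 b, so the
    right-hand side becomes exactly the one of [bounded]. *)
Lemma trivial_bound (b a c : nat) :
  (forall x, 1 < x -> 2 * b * x <= 2 * a + c * (x * x.-1)) ->
  2 * b * \sum_k #|B k| <= 2 * a * #|I| + c * (#|T| * #|T|.-1).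
Proof.
case: lsB => Bgt1 _ _ abc; rewrite -pairs_sum.
have le : \sum_k 2 * b * #|B k| <= \sum_k (2 * a * 1 + c * (#|B k| * #|B k|.-1)).
  by apply: leq_sum => k _; rewrite muln1; apply: abc.
by rewrite big_split /= -!big_distrr /= sum1_card in le.
Qed.

(** * Points of a given multiplicity, in total and on one line *)

Definition t_ (m : nat) : nat := \sum_k (#|B k| == m).
Definition deg (m : nat) (i : T) : nat := \sum_(k | i \in B k) (#|B k| == m).

Lemma sum_deg (m : nat) : \sum_i deg m i = m * t_ m.
Proof.
rewrite double_count big_distrr; apply: eq_bigr => k _ /=.
rewrite (_ : [set _ in _ | _] = B k); last by apply/setP => i; rewrite !inE andbT.
by case: eqP => [->|]; rewrite ?muln0.
Qed.

Let sum_pairs (P : pred I) : (\sum_(k | P k) 1) * (\sum_(k | P k) 1).-1 =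
  \sum_(k | P k) \sum_(l | P l && (l != k)) 1.
Proof.
rewrite big_distrl /=; apply: eq_bigr => k Pk.
by rewrite mul1n (bigD1 k) //= add1n.
Qed.

Let deg_sum1 (m : nat) (i : T) : deg m i = \sum_(k | (i \in B k) && (#|B k| == m)) 1.
Proof. by rewrite /deg [RHS]big_mkcondr. Qed.

Let sum_deg_meet (m : nat) : \sum_i deg m i * (deg m i).-1 =
  \sum_(k | #|B k| == m) \sum_(l | (#|B l| == m) && (l != k)) #|B l :&: B k|.
Proof.
under eq_bigr => i _ do rewrite deg_sum1 sum_pairs.
rewrite (exchange_big_dep (fun k => #|B k| == m)) //=; last by move=> i k _ /andP[].
apply: eq_bigr => k km.
rewrite (exchange_big_dep (fun l => (#|B l| == m) && (l != k))) //=; last first.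
  by move=> i l _ /andP[/andP[_ ->] ->].
apply: eq_bigr => l /andP[lm lk].
rewrite -[RHS]sum1_card; apply: eq_bigl => i.
by rewrite !inE km lm lk !andbT andbC.
Qed.

Let t_pairs (m : nat) : t_ m * (t_ m).-1 =
  \sum_(k | #|B k| == m) \sum_(l | (#|B l| == m) && (l != k)) 1.
Proof. by rewrite /t_ -sum_pairs -!big_mkcond. Qed.

(** An ordered pair of distinct [m]-fold points is counted once for each line through both, hence at
    most once. *)
Lemma sum_deg_pairs (m : nat) : \sum_i deg m i * (deg m i).-1 <= t_ m * (t_ m).-1.
Proof.
rewrite sum_deg_meet t_pairs; apply: leq_sum => k _; apply: leq_sum => l /andP[_ lk].
exact: card_meet.
Qed.

(** Equality in the count of pairs leaves no pair of [m]-fold points without a joining line. *)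
Lemma saturated_meet (m : nat) (k l : I) :
  t_ m * (t_ m).-1 <= \sum_i deg m i * (deg m i).-1 ->
  #|B k| = m -> #|B l| = m -> l != k -> exists2 i, i \in B k & i \in B l.
Proof.
rewrite sum_deg_meet t_pairs => sat /eqP km /eqP lm lk.
have le1 j : #|B j| == m ->
    \sum_(l | (#|B l| == m) && (l != j)) #|B l :&: B j| <=
    \sum_(l | (#|B l| == m) && (l != j)) 1.
  by move=> _; apply: leq_sum => n /andP[_ nj]; apply: card_meet.
have e1 := leq_sum_eq le1 sat km.
have meet1 n : (#|B n| == m) && (n != k) -> #|B n :&: B k| <= 1.
  by case/andP => _ nk; apply: card_meet.
have := @leq_sum_eq _ (fun n => (#|B n| == m) && (n != k)) _ (fun=> 1) meet1
  (eq_leq (esym e1)) l.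
rewrite lm lk => /(_ isT) meet.
have /card_gt0P[i ilk] : 0 < #|B l :&: B k| by rewrite meet.
by move: ilk; rewrite inE => /andP[il ik]; exists i.
Qed.

Lemma deg_ge (m : nat) (i : T) (s : seq I) :
  uniq s -> (forall k, k \in s -> i \in B k /\ #|B k| = m) -> size s <= deg m i.
Proof.
move=> uniq_s sm; rewrite deg_sum1 sum1dep_card cardE; apply: uniq_leq_size => //
  k /sm[ik km].
by rewrite mem_enum inE ik km eqxx.
Qed.

Lemma deg_le1 (m : nat) (i : T) (k0 : I) :
  (forall k, i \in B k -> #|B k| = m -> k = k0) -> deg m i <= 1.
Proof.
move=> only; rewrite deg_sum1 sum1dep_card -(cards1 k0); apply: subset_leq_card.
by apply/subsetP => k; rewrite !inE => /andP[ik /eqP km]; rewrite (only k).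
Qed.

Lemma deg_eq0 (m : nat) (i : T) (k : I) : deg m i = 0 -> i \in B k -> #|B k| <> m.
Proof.
rewrite deg_sum1 sum1dep_card => /eqP; rewrite cards_eq0 => /eqP/setP/(_ k).
by rewrite !inE => d0 ik km; rewrite ik km eqxx in d0.
Qed.

Lemma deg_gt0 (m : nat) (i : T) : 0 < deg m i -> exists2 k, i \in B k & #|B k| = m.
Proof.
rewrite deg_sum1 sum1dep_card => /card_gt0P[k]; rewrite inE => /andP[ik /eqP km].
by exists k.
Qed.

Lemma card_t_ (m : nat) : t_ m = #|[set k | #|B k| == m]|.
Proof. by rewrite /t_ -sum1dep_card [RHS]big_mkcond. Qed.

Lemma sizes_gt1 (k : I) : 1 < #|B k|.
Proof. by case: lsB. Qed.

Lemma split_sizes (P : pred I) (f : nat -> nat) : (forall k, #|B k| <= 4) ->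
  \sum_(k | P k) f #|B k| = f 2 * (\sum_(k | P k) (#|B k| == 2))
    + f 3 * (\sum_(k | P k) (#|B k| == 3)) + f 4 * (\sum_(k | P k) (#|B k| == 4)).
Proof.
move=> le4; rewrite !big_distrr -!big_split /=; apply: eq_bigr => k _.
by have := sizes_gt1 k; have := le4 k; case: #|B k| => [|[|[|[|[|]]]]] //; lia.
Qed.

Lemma degree_small (i : T) : (forall k, #|B k| <= 4) ->
  deg 2 i + 2 * deg 3 i + 3 * deg 4 i = #|T|.-1.
Proof. by move=> le4; rewrite -(degree_sum i) (split_sizes _ (fun x => x.-1)) // mul1n. Qed.

Lemma pairs_small : (forall k, #|B k| <= 4) ->
  2 * t_ 2 + 6 * t_ 3 + 12 * t_ 4 = #|T| * #|T|.-1.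
Proof. by move=> le4; rewrite -pairs_sum (split_sizes _ (fun x => x * x.-1)). Qed.

Lemma incidences_small : (forall k, #|B k| <= 4) ->
  \sum_k #|B k| = 2 * t_ 2 + 3 * t_ 3 + 4 * t_ 4.
Proof. exact: split_sizes id. Qed.

Lemma points_small : (forall k, #|B k| <= 4) -> #|I| = t_ 2 + t_ 3 + t_ 4.
Proof.
by move=> le4; rewrite -sum1_card (split_sizes _ (fun=> 1)) // !mul1n.
Qed.

Lemma max_size_split (m : nat) :
  (exists2 k0, m < #|B k0| & #|B k0| <= #|T|) \/ forall k, #|B k| <= m.
Proof.
case: (boolP [exists k, m < #|B k|]) => [/existsP[k mk]|/existsPn le]; [left|right].
  by exists k; rewrite // max_card.
by move=> k; rewrite leqNgt.
Qed.

(* [bounded b a] says that the Harbourne constant is at least [- a / b]. *)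
Definition bounded (b a : nat) : Prop := b * \sum_k #|B k| <= b * #|T| + a * #|I|.

Lemma sum_deg_le (m : nat) (f : T -> nat) :
  (forall i, deg m i <= f i) -> m * t_ m <= \sum_i f i.
Proof. by move=> le; rewrite -sum_deg; apply: leq_sum. Qed.

(** Each triple point on a line uses two of the at most 2 n + 1 other lines, so a line carries at
    most [n] of them. *)
Lemma triple_points_le (n : nat) : #|T| <= 2 * n + 2 -> (forall k, #|B k| <= 3) ->
  3 * t_ 3 <= #|T| * n /\ t_ 4 = 0.
Proof.
move=> dn le3; have le4 k : #|B k| <= 4 by apply: leq_trans (le3 k) _.
split.
  apply: leq_trans (@sum_deg_le 3 (fun=> n) _) _; last by rewrite sum_nat_const.
  by move=> i; have := degree_small i le4; lia.
by rewrite /t_ big1 // => k _; apply/eqP; rewrite eqb0; have := le3 k; lia.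
Qed.

(** * Sharp bounds for two to ten lines *)

Lemma bound2 : #|T| = 2 -> bounded 1 0.
Proof.
move=> d; have := @trivial_bound 1 0 2; rewrite /bounded d; move/(_ _)/wrap =>
  [[|[|x]] //= _|]; nia.
Qed.

Lemma bound3 : #|T| = 3 -> bounded 1 1.
Proof.
move=> d; have := @trivial_bound 1 1 1; rewrite /bounded d; move/(_ _)/wrap =>
  [[|[|x]] //= _|]; nia.
Qed.

Lemma bound4 : #|T| = 4 -> bounded 3 4.
Proof.
move=> d; have := @trivial_bound 3 4 2; rewrite /bounded d; move/(_ _)/wrap =>
  [[|[|x]] //= _|]; nia.
Qed.

Lemma bound5 : #|T| = 5 -> bounded 2 3.
Proof.
move=> d; have := @trivial_bound 2 3 1; rewrite /bounded d; move/(_ _)/wrap =>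
  [[|[|x]] //= _|]; nia.
Qed.

Lemma bound6 : #|T| = 6 -> bounded 7 12.
Proof.
move=> d; have [[k0 lo hi]|le3] := max_size_split 3.
  have := @pencil_bound 7 12 2 0 3 k0; rewrite /bounded d; move/(_ _)/wrap =>
    [[|[|x]] //= _|]; first nia.
  rewrite d in hi; by move: #|B k0| lo hi => [|[|[|[|[|[|[|m]]]]]]]; lia.
have [] := @triple_points_le 2 _ le3; first by rewrite d.
have le4 k : #|B k| <= 4 by apply: leq_trans (le3 k) _.
rewrite /bounded incidences_small // points_small //.
by have := pairs_small le4; rewrite d; lia.
Qed.

Lemma bound7 : #|T| = 7 -> bounded 1 2.
Proof.
move=> d; have [[k0 lo hi]|le3] := max_size_split 3.
  have := @pencil_bound 1 2 0 0 1 k0; rewrite /bounded d.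
  move/(_ _)/wrap => [[|[|x]] //= _|]; first nia.
  rewrite d in hi; by move: #|B k0| lo hi => [|[|[|[|[|[|[|[|m]]]]]]]]; lia.
have [] := @triple_points_le 3 _ le3; first by rewrite d.
have le4 k : #|B k| <= 4 by apply: leq_trans (le3 k) _.
rewrite /bounded incidences_small // points_small //.
by have := pairs_small le4; rewrite d; lia.
Qed.

(** Without quadruple points t_3 is at most 7; six triple points still satisfy the bound, and seven
    use up all 21 pairs of lines, leaving no double point. *)
Lemma bound7_or_fano : #|T| = 7 -> bounded 9 17 \/ forall k, #|B k| = 3.
Proof.
move=> d; have [[k0 lo hi]|le3] := max_size_split 3.
  left; have := @pencil_bound 9 17 1 0 7 k0; rewrite /bounded d.
  move/(_ _)/wrap => [[|[|x]] //= _|]; first nia.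
  rewrite d in hi; by move: #|B k0| lo hi => [|[|[|[|[|[|[|[|m]]]]]]]]; lia.
have [] := @triple_points_le 3 _ le3; first by rewrite d.
have le4 k : #|B k| <= 4 by apply: leq_trans (le3 k) _.
have := pairs_small le4; rewrite /bounded incidences_small // points_small // d.
move=> eq2 le t40; have [t36|t37] := leqP (t_ 3) 6; [left; lia|right=> k].
have t20 : t_ 2 == 0 by lia.
move: t20; rewrite sum_nat_eq0 => /forallP/(_ k)/=.
by rewrite eqb0 => ne2; have := sizes_gt1 k; have := le3 k; move: #|_| ne2; lia.
Qed.

Lemma bound8 : #|T| = 8 -> bounded 1 2.
Proof.
move=> d; have [[k0 lo hi]|le3] := max_size_split 3.
  have := @pencil_bound 1 2 0 0 1 k0; rewrite /bounded d.
  move/(_ _)/wrap => [[|[|x]] //= _|]; first nia.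
  rewrite d in hi; by move: #|B k0| lo hi => [|[|[|[|[|[|[|[|[|m]]]]]]]]]; lia.
have [] := @triple_points_le 3 _ le3; first by rewrite d.
have le4 k : #|B k| <= 4 by apply: leq_trans (le3 k) _.
rewrite /bounded incidences_small // points_small //.
by have := pairs_small le4; rewrite d; lia.
Qed.

Lemma bound9 : #|T| = 9 -> bounded 4 9.
Proof.
move=> d; have [[k0 lo hi]|le4] := max_size_split 4.
  have := @pencil_bound 4 9 0 1 6 k0; rewrite /bounded d.
  move/(_ _)/wrap => [[|[|x]] //= _|]; first nia.
  rewrite d in hi; by move: #|B k0| lo hi => [|[|[|[|[|[|[|[|[|[|m]]]]]]]]]]; lia.
rewrite /bounded incidences_small // points_small //.
(* Tight for deg 4 = 0, 1, 2 with deg 3 as large as the eight other lines allow. With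
   [sum_deg_pairs] it gives 6 t_3 + 13 t_4 <= 72 + t_4 (t_4 - 4). The goal is 6 t_3 + 13 t_4 <= 72,
   and [le'] yields t_4 <= 4. *)
have le : \sum_i (2 * deg 3 i + 4 * deg 4 i) <= \sum_i (8 * 1 + deg 4 i * (deg 4 i).-1).
  apply: leq_sum => i _; have := degree_small i le4; rewrite d.
  by move: (deg 2 i) (deg 3 i) (deg 4 i) => x y [|[|[|z]]]; nia.
have le' : \sum_i deg 4 i <= \sum_(i : T) 2 * 1.
  by apply: leq_sum => i _; have := degree_small i le4; rewrite d; lia.
rewrite !big_split /= -!big_distrr /= !sum_deg sum1_card d in le.
rewrite -big_distrr /= sum_deg sum1_card d in le'.
have := pairs_small le4; have := sum_deg_pairs 4; rewrite d.
move: (\sum_i _) le le' => q.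
by move: (t_ 4) => [|[|[|[|[|t4]]]]]; lia.
Qed.

(* The two exceptions are realized in characteristic 3 only. *)
Lemma ten_triple_points : #|T| = 10 -> (forall k, #|B k| <= 4) ->
  [\/ 23 * t_ 3 + 50 * t_ 4 <= 330, t_ 4 = 3 /\ 8 <= t_ 3 <= 9 | t_ 4 = 4 /\ t_ 3 = 6].
Proof.
move=> d le4; have pairs := sum_deg_pairs 4.
(* On each line deg 2 + 2 deg 3 + 3 deg 4 = 9. With deg 3 maximal, [le2] is tight at deg 4 = 1, 2,
   3; [le3] is tight at deg 4 = 2, 3. Using [pairs], [le1] bounds t_3 for t_4 <= 3, [le2] for t_4 =
   4 and 5, while [le3] excludes 6 and 7. *)
have le1 : \sum_i (deg 3 i + deg 4 i) <= \sum_(i : T) 4 * 1.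
  apply: leq_sum => i _; have := degree_small i le4; rewrite d; lia.
have le2 : \sum_i (2 * deg 3 i + 6 * deg 4 i) <= \sum_i (12 * 1 + deg 4 i * (deg 4 i).-1).
  apply: leq_sum => i _; have := degree_small i le4; rewrite d.
  by move: (deg 2 i) (deg 3 i) (deg 4 i) => x y [|[|[|[|z]]]]; nia.
have le3 : \sum_i (4 * deg 4 i) <= \sum_i (6 * 1 + deg 4 i * (deg 4 i).-1).
  apply: leq_sum => i _; have := degree_small i le4; rewrite d.
  by move: (deg 2 i) (deg 3 i) (deg 4 i) => x y [|[|[|[|z]]]]; nia.
have le4' : \sum_i (3 * deg 4 i) <= \sum_(i : T) 9 * 1.
  by apply: leq_sum => i _; have := degree_small i le4; rewrite d; lia.
rewrite !big_split /= -!big_distrr /= !sum_deg sum1_card d in le1 le2 le3 le4'.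
move: (t_ 4) (t_ 3) pairs le1 le2 le3 le4' => t4 t3.
move: (\sum_i _) => q; rewrite -ltnS => pairs le1 le2 le3 le4'.
have t4lt : t4 < 8 by lia.
(* This is [bounded 15 34] after eliminating t_2 = 45 - 3 t_3 - 6 t_4. *)
have [H|H] := leqP (23 * t3 + 50 * t4) 330; first by constructor 1.
move: t4lt pairs le1 le2 le3 le4' H.
case: t4 => [|[|[|[|[|[|[|[|t4]]]]]]]] //=; try by lia.
- by constructor 2; lia.
- by constructor 3; lia.
Qed.

Lemma bound10_pencil (k0 : I) : #|T| = 10 -> 4 < #|B k0| -> bounded 15 34.
Proof.
move=> d lo; have hi := max_card (B k0).
have := @pencil_bound 15 34 0 4 23 k0; rewrite /bounded d.
move/(_ _)/wrap => [[|[|x]] //= _|]; first nia.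
rewrite d in hi; by move: #|B k0| lo hi => [|[|[|[|[|[|[|[|[|[|[|m]]]]]]]]]]]; lia.
Qed.

(** For multiplicities up to 4 this amounts to 22 t_3 + 49 t_4 <= 345, with equality at t_4 = 3, t_3
    = 9, the type of [linesF3]. *)
Lemma bound10 : #|T| = 10 -> bounded 12 29.
Proof.
move=> d; have [[k0 lo hi]|le4] := max_size_split 4.
  by have := bound10_pencil d lo; rewrite /bounded; lia.
rewrite /bounded incidences_small // points_small //.
have := pairs_small le4; rewrite d.
by case: (ten_triple_points d le4); lia.
Qed.

Lemma bound10_or_exceptional : #|T| = 10 ->
  bounded 15 34 \/ (forall k, #|B k| <= 4) /\
    (t_ 4 = 3 /\ 8 <= t_ 3 \/ t_ 4 = 4 /\ t_ 3 = 6).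
Proof.
move=> d; have [[k0 lo hi]|le4] := max_size_split 4.
  by left; apply: bound10_pencil lo.
rewrite /bounded incidences_small // points_small //.
have := pairs_small le4; rewrite d.
by case: (ten_triple_points d le4); [left|right; split=> //|right; split=> //]; lia.
Qed.

End LinearSpace.

(** * Coordinates and the Fano plane *)

Definition det3 (R : pzRingType) (u v w : R * R * R) : R :=
  u.1.1 * (v.1.2 * w.2 - v.2 * w.1.2) - u.1.2 * (v.1.1 * w.2 - v.2 * w.1.1)
  + u.2 * (v.1.1 * w.1.2 - v.1.2 * w.1.1).

Lemma det3_xxy (R : comPzRingType) (u v : R * R * R) : det3 u u v = 0.
Proof. by rewrite /det3; ring. Qed.

Lemma det3_xyx (R : comPzRingType) (u v : R * R * R) : det3 u v u = 0.
Proof. by rewrite /det3; ring. Qed.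

Lemma det3_xyy (R : comPzRingType) (u v : R * R * R) : det3 u v v = 0.
Proof. by rewrite /det3; ring. Qed.

Section Basis.
Variables (K : fieldType) (x y z : K * K * K).

Definition lincomb (c : K * K * K) : K * K * K :=
  (c.1.1 * x.1.1 + c.1.2 * y.1.1 + c.2 * z.1.1,
   c.1.1 * x.1.2 + c.1.2 * y.1.2 + c.2 * z.1.2,
   c.1.1 * x.2 + c.1.2 * y.2 + c.2 * z.2).

Lemma det3_lincomb a b c :
  det3 (lincomb a) (lincomb b) (lincomb c) = det3 a b c * det3 x y z.
Proof. by rewrite /det3 /=; ring. Qed.

Definition coords (v : K * K * K) : K * K * K :=
  (det3 v y z / det3 x y z, det3 x v z / det3 x y z, det3 x y v / det3 x y z).

Lemma lincomb_coords v : det3 x y z != 0 -> lincomb (coords v) = v.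
Proof.
move=> D0; rewrite /lincomb /coords /=.
have cramer a b c : det3 v y z / det3 x y z * a + det3 x v z / det3 x y z * b
    + det3 x y v / det3 x y z * c =
    (det3 v y z * a + det3 x v z * b + det3 x y v * c) / det3 x y z by field.
rewrite !cramer; case: v {cramer} => [[v0 v1] v2].
by congr (_, _, _); apply: (mulIf D0); rewrite divfK // /det3 /=; ring.
Qed.

End Basis.

Section Represented.
Variables (T I : finType) (B : I -> {set T}) (K : fieldType).
Hypothesis lsB : linear_space B.

(** Three lines concur exactly when their determinant vanishes; this is the only trace of the field
    kept in the exceptional cases. *)
Definition represents (V : T -> K * K * K) : Prop :=
  forall l i j k, i != j -> i \in B l -> j \in B l ->
    (k \in B l) = (det3 (V i) (V j) (V k) == 0).

(** A change of basis multiplies all determinants by one nonzero factor, so any three non-concurrent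
    lines may serve as coordinate triangle. *)
Lemma represents_basis (V : T -> K * K * K) (l : I) (x y z : T) :
  represents V -> x != y -> x \in B l -> y \in B l -> z \notin B l ->
  exists V' : T -> K * K * K,
    [/\ represents V', V' x = (1, 0, 0), V' y = (0, 1, 0) & V' z = (0, 0, 1)].
Proof.
move=> repV xy xl yl; rewrite (repV l x y z xy xl yl) => D0.
exists (coords (V x) (V y) (V z) \o V); split=> [l' i j k ij il jl /=|||].
- rewrite (repV l' i j k ij il jl).
  by rewrite -[in LHS](lincomb_coords (V i) D0) -[in LHS](lincomb_coords (V j) D0)
    -[in LHS](lincomb_coords (V k) D0) det3_lincomb mulf_eq0 (negPf D0) orbF.
- by rewrite /= /coords mulfV // det3_xxy det3_xyx !mul0r.
- by rewrite /= /coords mulfV // det3_xxy det3_xyy !mul0r.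
- by rewrite /= /coords mulfV // det3_xyx det3_xyy !mul0r.
Qed.

Lemma third_line (l : I) (i j : T) : #|B l| = 3 -> i != j -> i \in B l -> j \in B l ->
  exists2 k, B l = [set i; j; k] & (k != i) && (k != j).
Proof.
move=> l3 ij il jl; have : #|B l :\ i :\ j| == 1%N.
  by have := cardsD1 i (B l); have := cardsD1 j (B l :\ i);
    rewrite !inE eq_sym ij il jl l3 /=; lia.
case/cards1P => k e; exists k; last first.
  by have : k \in B l :\ i :\ j; [rewrite e set11 | rewrite !inE => /and3P[-> ->]].
apply/setP => m; have [->|mi] := eqVneq m i; first by rewrite il !inE eqxx.
have [->|mj] := eqVneq m j; first by rewrite jl !inE eqxx orbT.
by have /setP/(_ m) := e; rewrite !inE mi mj (negPf mi) (negPf mj).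
Qed.

(** Naming the determinant [c] lets each use supply it in simplified form, to be checked by
    [ring]. *)
Lemma mem_point (V : T -> K * K * K) (c : K) (l : I) (i j k : T) : represents V ->
  det3 (V i) (V j) (V k) = c -> i != j -> i \in B l -> j \in B l -> (k \in B l) = (c == 0).
Proof. by move=> repV <-; apply: repV. Qed.

(** The third lines [p], [q], [r] at the vertices of the triangle [x], [y], [z] are cevians. They
    concur, and their feet on the opposite sides lie on [s]. Ceva ([e6]) gives p0 q1 r2 = - p1 q2 r0
    and Menelaus ([eN]) the same equation without the sign, hence 2 = 0. *)
Lemma fano_char2 (V : T -> K * K * K) : #|T| = 7%N -> (forall k, #|B k| = 3) ->
  represents V -> (2%:R : K) = 0.
Proof.
move=> T7 B3 repV; case: (lsB) => _ Bex Bun.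
have third i j : i != j -> exists l k,
    [/\ i \in B l, j \in B l, k \in B l, k != i & k != j].
  move=> ij; have [l il jl] := Bex i j ij;
    have [k e /andP[ki kj]] := third_line (B3 l) ij il jl.
  by exists l, k; split=> //; rewrite e !inE eqxx !orbT.
have [x [y [_ _ xy]]] : exists x y : T, [/\ x \in T, y \in T & x != y].
  by apply/card_gt1P; rewrite T7.
have [l [p [xl yl pl px py]]] := third x y xy.
have [z zl] : exists z, z \notin B l.
  apply/existsP; apply: contraT => /existsPn all_l.
  have := B3 l; rewrite (_ : B l = setT) ?cardsT ?T7 //.
  by apply/setP => i; rewrite inE; have := all_l i; rewrite negbK.
have [W [repW Wx Wy Wz]] := represents_basis repV xy xl yl zl.
have yz : y != z by apply: contraNneq zl => <-.
have xz : x != z by apply: contraNneq zl => <-.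
have pz : p != z by apply: contraNneq zl => <-.
have [l1 [q [yl1 zl1 ql1 qy qz]]] := third y z yz.
have [l2 [r [xl2 zl2 rl2 rx rz]]] := third x z xz.
have [l3 [s [pl3 zl3 sl3 sp sz]]] := third p z pz.
case Ep : (W p) => [[p0 p1] p2]; case Eq : (W q) => [[q0 q1] q2].
case Er : (W r) => [[r0 r1] r2]; case Es : (W s) => [[s0 s1] s2].
have [xp yp] : x != p /\ y != p by rewrite ![_ == p]eq_sym.
have p2z : p2 = 0.
  by apply/eqP; rewrite -(mem_point (c := p2) (k := p) repW _ xy xl yl) //
    Wx Wy Ep /det3 /=; ring.
have q0z : q0 = 0.
  by apply/eqP; rewrite -(mem_point (c := q0) (k := q) repW _ yz yl1 zl1) //
    Wy Wz Eq /det3 /=; ring.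
have r1z : - r1 = 0.
  by apply/eqP; rewrite -(mem_point (c := - r1) (k := r) repW _ xz xl2 zl2) //
    Wx Wz Er /det3 /=; ring.
move/eqP: r1z; rewrite oppr_eq0 => /eqP r1z; subst p2 q0 r1.
have p0n : p0 != 0.
  by rewrite -(mem_point (c := p0) (k := z) repW _ py pl yl) // Wy Wz Ep /det3 /=; ring.
have p1n : p1 != 0.
  by rewrite -(mem_point (c := p1) (k := z) repW _ xp xl pl) // Wx Wz Ep /det3 /=; ring.
have xl1 : x \notin B l1.
  by rewrite (mem_point (c := 1) (k := x) repW _ yz yl1 zl1) ?oner_eq0 //
    Wx Wy Wz /det3 /=; ring.
have yl2 : y \notin B l2.
  by rewrite (mem_point (c := -1) (k := y) repW _ xz xl2 zl2) ?oppr_eq0 ?oner_eq0 //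
    Wx Wy Wz /det3 /=; ring.
have q1n : q1 != 0.
  by rewrite -(mem_point (c := q1) (k := x) repW _ qz ql1 zl1) // Wx Wz Eq /det3 /=; ring.
have q2n : - q2 != 0.
  by rewrite -(mem_point (c := - q2) (k := x) repW _ qy ql1 yl1) // Wx Wy Eq /det3 /=; ring.
have r0n : - r0 != 0.
  by rewrite -(mem_point (c := - r0) (k := y) repW _ rz rl2 zl2) // Wy Wz Er /det3 /=; ring.
have r2n : - r2 != 0.
  rewrite -(mem_point (c := - r2) (k := y) repW _ _ xl2 rl2) // 1?eq_sym //.
  by rewrite Wx Wy Er /det3 /=; ring.
rewrite !oppr_eq0 in q2n r0n r2n.
have xl3 : x \notin B l3.
  by rewrite (mem_point (c := p1) (k := x) repW _ pz pl3 zl3) // Wx Wz Ep /det3 /=; ring.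
have yl3 : y \notin B l3.
  rewrite (mem_point (c := - p0) (k := y) repW _ pz pl3 zl3) ?oppr_eq0 //.
  by rewrite Wy Wz Ep /det3 /=; ring.
have s0n : - s0 != 0.
  by rewrite -(mem_point (c := - s0) (k := y) repW _ sz sl3 zl3) // Wy Wz Es /det3 /=; ring.
have s1n : s1 != 0.
  by rewrite -(mem_point (c := s1) (k := x) repW _ sz sl3 zl3) // Wx Wz Es /det3 /=; ring.
have s2n : - (p1 * s2) != 0.
  rewrite -(mem_point (c := - (p1 * s2)) (k := x) repW _ sp sl3 pl3) //.
  by rewrite Wx Ep Es /det3 /=; ring.
rewrite oppr_eq0 in s0n; rewrite oppr_eq0 mulf_eq0 negb_or in s2n; case/andP: s2n => _ s2n.
have e1 : p1 * s0 - p0 * s1 = 0.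
  apply/eqP; rewrite -(mem_point (c := p1 * s0 - p0 * s1) (k := s) repW _ pz pl3 zl3) //.
  by rewrite Wz Ep Es /det3 /=; ring.
have uniq7 : uniq [:: x; y; z; p; q; r; s].
  apply: (@map_uniq _ _ W); rewrite /= Wx Wy Wz Ep Eq Er Es !inE !xpair_eqE !eqxx !(eq_sym 0).
  by rewrite ?oner_eq0 ?(negPf p0n, negPf p1n, negPf q1n, negPf q2n, negPf r0n, negPf r2n,
    negPf s0n, negPf s1n, negPf s2n) ?andbF /= ?andbF.
have cover7 m : m \in [:: x; y; z; p; q; r; s].
  have [||_ ->] := uniq_min_size uniq7 (s2 := enum T); last by rewrite mem_enum.
    by move=> i _; rewrite mem_enum.
  by rewrite -cardE T7.
have xq : x != q by apply: contraTneq uniq7 => ->; rewrite /= !inE eqxx ?orbT.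
have yr : y != r by apply: contraTneq uniq7 => ->; rewrite /= !inE eqxx ?orbT ?andbF.
have pq : p != q by apply: contraTneq uniq7 => ->; rewrite /= !inE eqxx ?orbT ?andbF.
have [l4 [m4 [xl4 ql4 m4l4 m4x m4q]]] := third x q xq.
(* By elimination: for every other candidate the determinant is, up to sign, a product of nonzero
   coordinates. *)
have em4 : m4 = s.
  have := cover7 m4; rewrite !inE (negPf m4x) (negPf m4q) /=.
  case/or4P => [/eqP em|/eqP em|/eqP em|/orP[/eqP em|/eqP em]] //; move: m4l4; rewrite em.
  - rewrite (mem_point (c := - q2) repW _ xq xl4 ql4) ?oppr_eq0 ?mulf_eq0 ?(negPf q2n) //.
    by rewrite Wx Eq Wy /det3 /=; ring.
  - rewrite (mem_point (c := q1) repW _ xq xl4 ql4) ?oppr_eq0 ?mulf_eq0 ?(negPf q1n) //.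
    by rewrite Wx Eq Wz /det3 /=; ring.
  - rewrite (mem_point (c := - (q2 * p1)) repW _ xq xl4 ql4) ?oppr_eq0 ?mulf_eq0
    ?(negPf q2n) ?(negPf p1n) //.
    by rewrite Wx Eq Ep /det3 /=; ring.
  - rewrite (mem_point (c := q1 * r2) repW _ xq xl4 ql4) ?oppr_eq0 ?mulf_eq0
    ?(negPf q1n) ?(negPf r2n) //.
    by rewrite Wx Eq Er /det3 /=; ring.
have [l5 [m5 [yl5 rl5 m5l5 m5y m5r]]] := third y r yr.
have em5 : m5 = s.
  have := cover7 m5; rewrite !inE (negPf m5y) (negPf m5r) /=.
  case/or4P => [/eqP em|/eqP em|/eqP em|/orP[/eqP em|/eqP em]] //; move: m5l5; rewrite em.
  - rewrite (mem_point (c := r2) repW _ yr yl5 rl5) ?oppr_eq0 ?mulf_eq0 ?(negPf r2n) //.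
    by rewrite Wy Er Wx /det3 /=; ring.
  - rewrite (mem_point (c := - r0) repW _ yr yl5 rl5) ?oppr_eq0 ?mulf_eq0 ?(negPf r0n) //.
    by rewrite Wy Er Wz /det3 /=; ring.
  - rewrite (mem_point (c := r2 * p0) repW _ yr yl5 rl5) ?oppr_eq0 ?mulf_eq0
    ?(negPf r2n) ?(negPf p0n) //.
    by rewrite Wy Er Ep /det3 /=; ring.
  - rewrite (mem_point (c := - (r0 * q2)) repW _ yr yl5 rl5) ?oppr_eq0 ?mulf_eq0
    ?(negPf r0n) ?(negPf q2n) //.
    by rewrite Wy Er Eq /det3 /=; ring.
subst m4 m5.
have e4 : q1 * s2 - q2 * s1 = 0.
  apply/eqP; rewrite -(mem_point (c := q1 * s2 - q2 * s1) (k := s) repW _ xq xl4 ql4) //.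
  by rewrite Wx Eq Es /det3 /=; ring.
have e5 : r2 * s0 - r0 * s2 = 0.
  apply/eqP; rewrite -(mem_point (c := r2 * s0 - r0 * s2) (k := s) repW _ yr yl5 rl5) //.
  by rewrite Wy Er Es /det3 /=; ring.
have [l6 [m6 [pl6 ql6 m6l6 m6p m6q]]] := third p q pq.
have em6 : m6 = r.
  have := cover7 m6; rewrite !inE (negPf m6p) (negPf m6q) /=.
  case/or4P => [/eqP em|/eqP em|/eqP em|/orP[/eqP em|/eqP em]] //; move: m6l6; rewrite em.
  - rewrite (mem_point (c := p1 * q2) repW _ pq pl6 ql6) ?oppr_eq0 ?mulf_eq0
    ?(negPf p1n) ?(negPf q2n) //.
    by rewrite Ep Eq Wx /det3 /=; ring.
  - rewrite (mem_point (c := - (p0 * q2)) repW _ pq pl6 ql6) ?oppr_eq0 ?mulf_eq0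
    ?(negPf p0n) ?(negPf q2n) //.
    by rewrite Ep Eq Wy /det3 /=; ring.
  - rewrite (mem_point (c := p0 * q1) repW _ pq pl6 ql6) ?oppr_eq0 ?mulf_eq0
    ?(negPf p0n) ?(negPf q1n) //.
    by rewrite Ep Eq Wz /det3 /=; ring.
  - rewrite (mem_point (c := p1 * q2 * s0) repW _ pq pl6 ql6) ?oppr_eq0 ?mulf_eq0
    ?(negPf p1n) ?(negPf q2n) ?(negPf s0n) //.
    by rewrite -[RHS]addr0 -(mulr0 p0) -e4 Ep Eq Es /det3 /=; ring.
subst m6.
have e6 : p0 * q1 * r2 + p1 * q2 * r0 = 0.
  apply/eqP; rewrite -(mem_point (c := p0 * q1 * r2 + p1 * q2 * r0)
    (k := r) repW _ pq pl6 ql6) //.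
  by rewrite Ep Eq Er /det3 /=; ring.
move/subr0_eq: e1 => e1; move/subr0_eq: e4 => e4; move/subr0_eq: e5 => e5.
have eN : p0 * q1 * r2 = p1 * q2 * r0.
  apply: (mulIf (mulf_neq0 s0n (mulf_neq0 s1n s2n))).
  transitivity (p0 * s1 * (q1 * s2) * (r2 * s0)); first by ring.
  by rewrite -e1 e4 e5; ring.
apply: (mulIf (mulf_neq0 p0n (mulf_neq0 q1n r2n))).
by rewrite mul0r -[RHS]e6 -eN; ring.
Qed.
End Represented.

(** * Ten lines with several quadruple points *)

Lemma fourth_element (T : finType) (S : {set T}) (x y z : T) : #|S| = 4%N ->
  uniq [:: x; y; z] -> x \in S -> y \in S -> z \in S ->
  exists2 a, a \in S & [/\ a != x, a != y, a != z &
    forall m, m \in S -> m \in [:: x; y; z; a]].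
Proof.
rewrite /= !inE negb_or => S4 /andP[/andP[xy xz] /andP[yz _]] xS yS zS.
have : #|S :\ x :\ y :\ z| == 1%N.
  have := cardsD1 x S; have := cardsD1 y (S :\ x); have := cardsD1 z (S :\ x :\ y).
  by rewrite !inE ![_ == x]eq_sym [_ == y]eq_sym xy xz yz xS yS zS S4 /=; lia.
case/cards1P => a e; have : a \in S :\ x :\ y :\ z by rewrite e set11.
rewrite !inE => /and4P[az ay ax aS]; exists a; rewrite ?az ?ay ?ax //; split=> // m mS.
rewrite !inE; have /setP/(_ m) := e; rewrite !inE mS andbT => <-.
by case: (m == x); case: (m == y); case: (m == z).
Qed.

Section Exceptional.
Variables (T I : finType) (B : I -> {set T}).
Hypothesis lsB : linear_space B.
Hypothesis T10 : #|T| = 10%N.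
Hypothesis le4 : forall k, (#|B k| <= 4)%N.

Lemma same_point (k l : I) (i j : T) :
  i != j -> i \in B k -> j \in B k -> i \in B l -> j \in B l -> k = l.
Proof. by case: lsB => _ _; apply. Qed.

Lemma joining_point (i j : T) : i != j -> exists2 k, i \in B k & j \in B k.
Proof. by case: lsB => _ + _; apply. Qed.

Section OppositeEdges.
Variables (A1 A2 A3 A4 : I).
Hypothesis quad : forall k, (#|B k| == 4%N) = [|| k == A1, k == A2, k == A3 | k == A4].
Hypothesis covered : forall i, exists2 k, i \in B k & #|B k| = 4%N.

(** The common point of [a] and [w] is neither double nor quadruple, so a third line [m] passes
    through it. That line contains some quadruple point, which cannot be [A1], already on [a], nor
    [A3] or [A4], already on [w]; hence it is [A2] and the line is [b]. *)
Lemma opposite_edge (a b w : T) :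
  a \in B A1 -> a \notin B A2 -> a \notin B A3 -> a \notin B A4 -> deg B 2 a = 0%N ->
  w \in B A3 -> w \in B A4 -> w \notin B A1 ->
  (forall m, m \in B A2 -> m \notin B A1 -> m \notin B A3 -> m \notin B A4 -> m = b) ->
  exists l, [/\ a \in B l, b \in B l & w \in B l].
Proof.
move=> a1 a2 a3 a4 deg2 w3 w4 w1 onlyb.
have aw : a != w by apply: contraNneq w1 => <-.
have [l al wl] := joining_point aw; exists l.
have l4 : #|B l| != 4%N.
  rewrite quad; apply/or4P => [] [] /eqP el; move: al wl; rewrite el.
  - by rewrite (negPf w1).
  - by rewrite (negPf a2).
  - by rewrite (negPf a3).
  - by rewrite (negPf a4).
have l2 := deg_eq0 deg2 al.
have l3 : #|B l| = 3%N by have := le4 l; have := sizes_gt1 lsB l; lia.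
have [m Bl /andP[ma mw]] := third_line l3 aw al wl.
have ml : m \in B l by rewrite Bl !inE eqxx !orbT.
suff <- : m = b by [].
have [k mk /eqP] := covered m.
have notin A i : i \in B A -> i \in B l -> m != i -> #|B A| == 4%N -> m \notin B A.
  by move=> iA il mi A4'; apply: contraNN l4 => mA; rewrite (same_point mi ml il mA iA).
have [m1 m3 m4] : [/\ m \notin B A1, m \notin B A3 & m \notin B A4].
  by split; [apply: (notin _ a)|apply: (notin _ w)|apply: (notin _ w)];
    rewrite // quad eqxx ?orbT.
rewrite quad => /or4P[] /eqP ek; rewrite ek in mk.
- by rewrite mk in m1.
- exact: onlyb.
- by rewrite mk in m3.
- by rewrite mk in m4.
Qed.
End OppositeEdges.

(** * Four quadruple points in a complete quadrangle *)

Section FourQuadruplePoints.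
Hypotheses (t4 : t_ B 4 = 4%N) (t3 : t_ B 3 = 6%N).

(** Both inequalities, summed over the lines, are equalities here (32 = 20 + 12 and 132 = 120 + 12),
    so they are equalities on each line. The first leaves deg 4 = 1 or 2, and the second then
    determines deg 3. *)
Lemma four_quadruple_degrees (i : T) :
  (deg B 4 i = 1 \/ deg B 4 i = 2)%N /\ (deg B 4 i = 1 -> deg B 2 i = 0)%N.
Proof.
have sat := sum_deg_pairs lsB 4; rewrite t4 in sat.
have dsum j := degree_small lsB j le4.
have le j : true -> (2 * deg B 4 j <= 2 * 1 + deg B 4 j * (deg B 4 j).-1)%N by nia.
have eq4 := @leq_sum_eq _ xpredT _ _ le _ i isT.
rewrite big_split /= -!big_distrr /= sum_deg t4 sum1_card T10 in eq4.
have {}eq4 := eq4 ltac:(lia).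
have le' j : true ->
    (2 * deg B 3 j + 6 * deg B 4 j <= 12 * 1 + deg B 4 j * (deg B 4 j).-1)%N.
  move=> _; have := dsum j; rewrite T10.
  by move: (deg B 2 j) (deg B 3 j) (deg B 4 j) => a b [|[|[|[|c]]]]; nia.
have eq3 := @leq_sum_eq _ xpredT _ _ le' _ i isT.
rewrite !big_split /= -!big_distrr /= !sum_deg t4 t3 sum1_card T10 in eq3.
have {}eq3 := eq3 ltac:(lia).
have := dsum i; rewrite T10; move: eq3 eq4.
by move: (deg B 2 i) (deg B 3 i) (deg B 4 i) => a b [|[|[|[|c]]]]; lia.
Qed.

Lemma four_quadruple_meet (k l : I) : #|B k| = 4%N -> #|B l| = 4%N -> l != k ->
  exists2 i, i \in B k & i \in B l.
Proof.
apply: saturated_meet => //; rewrite t4.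
have le : (\sum_i (2 * deg B 4 i) <= \sum_i (2 * 1 + deg B 4 i * (deg B 4 i).-1))%N.
  by apply: leq_sum => i _; nia.
rewrite [leqRHS]big_split /= -!big_distrr /= sum_deg t4 sum1_card T10 in le; lia.
Qed.

(** The quadrangle A, B, C, D has sides [x] = BC, [y] = CA, [z] = AB, [u] = AD, [v] = BD, [w] = CD,
    and [a], [b], [c], [d] are the remaining lines through its vertices. By [opposite_edge] each
    side meets the extra lines of the two other vertices in one point; five of these concurrences
    and the one at D suffice in coordinates with triangle [x], [y], [z]. *)
Lemma four_quadruple_char3 (K : fieldType) (V : T -> K * K * K) :
  represents B V -> (3%:R : K) = 0.
Proof.
move=> repV.
have : size (enum [set k | #|B k| == 4%N]) = 4%N by rewrite -cardE -card_t_.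
have := enum_uniq [set k | #|B k| == 4%N].
have := mem_enum [set k | #|B k| == 4%N].
case: (enum _) => [|kA [|kB [|kC [|kD [|]]]]] // memQ.
rewrite /= !inE !negb_or => /and4P[/and3P[AB AC AD] /andP[BC BD] CD _] _.
have quad k : (#|B k| == 4%N) = [|| k == kA, k == kB, k == kC | k == kD].
  by have := memQ k; rewrite !inE => <-.
have [A4 B4 C4 D4] : [/\ #|B kA| = 4%N, #|B kB| = 4%N, #|B kC| = 4%N & #|B kD| = 4%N].
  by split; apply/eqP; rewrite quad eqxx ?orbT.
have covered i : exists2 k, i \in B k & #|B k| = 4%N.
  by apply: deg_gt0; case: (four_quadruple_degrees i) => [[] ->].
have not3 k l m i : k != l -> m != k -> m != l -> #|B k| = 4%N -> #|B l| = 4%N ->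
    #|B m| = 4%N -> i \in B k -> i \in B l -> i \notin B m.
  move=> kl mk ml k4 l4 m4 ik il; apply/negP => im.
  have := @deg_ge _ _ B 4 i [:: k; l; m].
  rewrite /= !inE negb_or kl [k == m]eq_sym mk [l == m]eq_sym ml /=.
  case/(_ _ _)/wrap => [//|n|]; first by rewrite !inE => /or3P[] /eqP->.
  by case: (four_quadruple_degrees i) => [[] ->].
have [BA CA DA] : [/\ kB != kA, kC != kA & kD != kA] by split; rewrite eq_sym.
have [CB DB DC] : [/\ kC != kB, kD != kB & kD != kC].
  by split; rewrite eq_sym.
have [x xB xC] := four_quadruple_meet B4 C4 CB.
have [y yA yC] := four_quadruple_meet A4 C4 CA.
have [z zA zB] := four_quadruple_meet A4 B4 BA.
have [u uA uD] := four_quadruple_meet A4 D4 DA.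
have [v vB vD] := four_quadruple_meet B4 D4 DB.
have [w wC wD] := four_quadruple_meet C4 D4 DC.
have xA : x \notin B kA by apply: (not3 kB kC).
have xD : x \notin B kD by apply: (not3 kB kC).
have yB : y \notin B kB by apply: (not3 kA kC).
have yD : y \notin B kD by apply: (not3 kA kC).
have zC : z \notin B kC by apply: (not3 kA kB).
have zD : z \notin B kD by apply: (not3 kA kB).
have uB : u \notin B kB by apply: (not3 kA kD).
have uC : u \notin B kC by apply: (not3 kA kD).
have vA : v \notin B kA by apply: (not3 kB kD).
have vC : v \notin B kC by apply: (not3 kB kD).
have wA : w \notin B kA by apply: (not3 kC kD).
have wB : w \notin B kB by apply: (not3 kC kD).
have ne k i j : i \in B k -> j \notin B k -> i != j.
  by move=> ik; apply: contraNneq => <-.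
have [xy xz yz] : [/\ x != y, x != z & y != z].
  by split; [apply: (ne kB)|apply: (ne kC)|apply: (ne kC)].
have [uv uw vw] : [/\ u != v, u != w & v != w].
  by split; [apply: (ne kA)|apply: (ne kA)|apply: (ne kB)].
have [a aA [ay az au onlyA]] : exists2 a, a \in B kA & [/\ a != y, a != z, a != u &
    forall m, m \in B kA -> m \in [:: y; z; u; a]].
  by apply: fourth_element => //; rewrite /= !inE negb_or yz (ne kC) // (ne kB).
have [b bB [bx bz bv onlyB]] : exists2 b, b \in B kB & [/\ b != x, b != z, b != v &
    forall m, m \in B kB -> m \in [:: x; z; v; b]].
  by apply: fourth_element => //; rewrite /= !inE negb_or xz (ne kC) // (ne kA).
have [c cC [cx cy cw onlyC]] : exists2 c, c \in B kC & [/\ c != x, c != y, c != w &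
    forall m, m \in B kC -> m \in [:: x; y; w; c]].
  by apply: fourth_element => //; rewrite /= !inE negb_or xy (ne kB) // (ne kA).
have [d dD [du dv dw onlyD]] : exists2 d, d \in B kD & [/\ d != u, d != v, d != w &
    forall m, m \in B kD -> m \in [:: u; v; w; d]].
  by apply: fourth_element => //; rewrite /= !inE negb_or uv uw vw.
have priv k l i j : i != j -> i \in B k -> j \in B k -> j \in B l -> k != l -> i \notin B l.
  by move=> ij ik jk jl; apply: contraNN => il; apply/eqP; apply: (same_point ij).
have [aB aC aD] : [/\ a \notin B kB, a \notin B kC & a \notin B kD].
  by split; [apply: (priv kA _ _ z)|apply: (priv kA _ _ y)|apply: (priv kA _ _ u)].
have [bA bC bD] : [/\ b \notin B kA, b \notin B kC & b \notin B kD].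
  by split; [apply: (priv kB _ _ z)|apply: (priv kB _ _ x)|apply: (priv kB _ _ v)].
have [cA cB cD] : [/\ c \notin B kA, c \notin B kB & c \notin B kD].
  by split; [apply: (priv kC _ _ y)|apply: (priv kC _ _ x)|apply: (priv kC _ _ w)].
have [dA dB dC] : [/\ d \notin B kA, d \notin B kB & d \notin B kC].
  by split; [apply: (priv kD _ _ u)|apply: (priv kD _ _ v)|apply: (priv kD _ _ w)].
have deg2 i k0 : (forall k, #|B k| == 4%N -> i \in B k -> k = k0) -> deg B 2 i = 0%N.
  move=> only; apply: (proj2 (four_quadruple_degrees i)).
  have := @deg_le1 _ _ B 4 i k0 (fun k ik k4 => only k (introT eqP k4) ik).
  by case: (four_quadruple_degrees i) => [[] ->].
have deg2a : deg B 2 a = 0%N.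
  by apply: (deg2 a kA) => k; rewrite quad => /or4P[] /eqP-> //;
    rewrite ?(negPf aB) ?(negPf aC) ?(negPf aD).
have deg2b : deg B 2 b = 0%N.
  by apply: (deg2 b kB) => k; rewrite quad => /or4P[] /eqP-> //;
    rewrite ?(negPf bA) ?(negPf bC) ?(negPf bD).
have deg2c : deg B 2 c = 0%N.
  by apply: (deg2 c kC) => k; rewrite quad => /or4P[] /eqP-> //;
    rewrite ?(negPf cA) ?(negPf cB) ?(negPf cD).
have onlyc m : m \in B kC -> m \notin B kA -> m \notin B kB -> m \notin B kD -> m = c.
  by move/onlyC; rewrite !inE => /or4P[] /eqP-> //; rewrite ?xB ?yA ?wD.
have onlyd m : m \in B kD -> m \notin B kA -> m \notin B kB -> m \notin B kC -> m = d.
  by move/onlyD; rewrite !inE => /or4P[] /eqP-> //; rewrite ?uA ?vB ?wC.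
have [l1 [l1c l1d l1z]] : exists l, [/\ c \in B l, d \in B l & z \in B l].
  apply: (opposite_edge (A1 := kC) (A2 := kD) (A3 := kA) (A4 := kB)) => //; last by eauto.
  by move=> k; rewrite quad; do 4 case: (k == _).
have [l2 [l2a l2d l2x]] : exists l, [/\ a \in B l, d \in B l & x \in B l].
  apply: (opposite_edge (A1 := kA) (A2 := kD) (A3 := kB) (A4 := kC)) => //.
  by move=> k; rewrite quad; do 4 case: (k == _).
have [l3 [l3b l3d l3y]] : exists l, [/\ b \in B l, d \in B l & y \in B l].
  apply: (opposite_edge (A1 := kB) (A2 := kD) (A3 := kA) (A4 := kC)) => //; last by eauto.
  by move=> k; rewrite quad; do 4 case: (k == _).
have [l4 [l4a l4c l4v]] : exists l, [/\ a \in B l, c \in B l & v \in B l].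
  apply: (opposite_edge (A1 := kA) (A2 := kC) (A3 := kB) (A4 := kD)) => //.
  by move=> k; rewrite quad; do 4 case: (k == _).
have [l5 [l5b l5c l5u]] : exists l, [/\ b \in B l, c \in B l & u \in B l].
  apply: (opposite_edge (A1 := kB) (A2 := kC) (A3 := kA) (A4 := kD)) => //; last by eauto.
  by move=> k; rewrite quad; do 4 case: (k == _).
have [W [repW Wx Wy Wz]] := represents_basis repV xy xC yC zC.
case Eu : (W u) => [[u0 u1] u2].
case Ev : (W v) => [[v0 v1] v2].
case Ea : (W a) => [[a0 a1] a2].
case Eb : (W b) => [[b0 b1] b2].
case Ec : (W c) => [[c0 c1] c2].
case Ed : (W d) => [[d0 d1] d2].
have u0z : u0 = 0.
  by apply/eqP; rewrite -(mem_point (c := u0) (k := u) (l := kA) repW _ yz) //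
    Wy Wz Eu /det3 /=; ring.
have v1z : - v1 = 0.
  by apply/eqP; rewrite -(mem_point (c := - v1) (k := v) (l := kB) repW _ xz) //
    Wx Wz Ev /det3 /=; ring.
have a0z : a0 = 0.
  by apply/eqP; rewrite -(mem_point (c := a0) (k := a) (l := kA) repW _ yz) //
    Wy Wz Ea /det3 /=; ring.
have b1z : - b1 = 0.
  by apply/eqP; rewrite -(mem_point (c := - b1) (k := b) (l := kB) repW _ xz) //
    Wx Wz Eb /det3 /=; ring.
have c2z : c2 = 0.
  by apply/eqP; rewrite -(mem_point (c := c2) (k := c) (l := kC) repW _ xy) //
    Wx Wy Ec /det3 /=; ring.
move/eqP: v1z; move/eqP: b1z; rewrite !oppr_eq0 => /eqP b1z /eqP v1z; subst u0 v1 a0 b1 c2.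
have a2n : - a2 != 0.
  by rewrite -(mem_point (c := - a2) (k := x) (l := kA) repW _ ay) // Ea Wy Wx /det3 /=;
    ring.
have c0n : c0 != 0.
  by rewrite -(mem_point (c := c0) (k := z) (l := kC) repW _ cy) // Ec Wy Wz /det3 /=; ring.
have b2n : b2 != 0.
  by rewrite -(mem_point (c := b2) (k := y) (l := kB) repW _ bx) // Eb Wx Wy /det3 /=; ring.
have [uz vz] : u != z /\ v != z by split; [apply: (ne kD)|apply: (ne kD)].
have u1n : u1 != 0.
  by rewrite -(mem_point (c := u1) (k := x) (l := kA) repW _ uz) // Eu Wz Wx /det3 /=; ring.
have v0n : - v0 != 0.
  by rewrite -(mem_point (c := - v0) (k := y) (l := kB) repW _ vz) // Ev Wz Wy /det3 /=;
    ring.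
have d0n : d0 != 0.
  by rewrite -(mem_point (c := d0) (k := d) (l := kA) repW _ yz) // Wy Wz Ed /det3 /=; ring.
have d1n : - d1 != 0.
  by rewrite -(mem_point (c := - d1) (k := d) (l := kB) repW _ xz) // Wx Wz Ed /det3 /=;
    ring.
have d2n : d2 != 0.
  by rewrite -(mem_point (c := d2) (k := d) (l := kC) repW _ xy) // Wx Wy Ed /det3 /=; ring.
rewrite !oppr_eq0 in a2n v0n d1n.
have [cd ad bd] : [/\ c != d, a != d & b != d].
  by split; [apply: (ne kC)|apply: (ne kA)|apply: (ne kB)].
have [ac bc] : a != c /\ b != c by split; [apply: (ne kA)|apply: (ne kB)].
have e1 : c0 * d1 - c1 * d0 = 0.
  by apply/eqP; rewrite -(mem_point (c := c0 * d1 - c1 * d0)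
    (k := z) (l := l1) repW _ cd) // Ec Ed Wz /det3 /=; ring.
have e2 : a1 * d2 - a2 * d1 = 0.
  by apply/eqP; rewrite -(mem_point (c := a1 * d2 - a2 * d1)
    (k := x) (l := l2) repW _ ad) // Ea Ed Wx /det3 /=; ring.
have e3 : b2 * d0 - b0 * d2 = 0.
  by apply/eqP; rewrite -(mem_point (c := b2 * d0 - b0 * d2)
    (k := y) (l := l3) repW _ bd) // Eb Ed Wy /det3 /=; ring.
have e5 : - (a1 * c0 * v2 + a2 * c1 * v0) = 0.
  by apply/eqP; rewrite -(mem_point (c := - (a1 * c0 * v2 + a2 * c1 * v0))
    (k := v) (l := l4) repW _ ac) // Ea Ec Ev /det3 /=; ring.
have e6 : b0 * c1 * u2 + b2 * c0 * u1 = 0.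
  by apply/eqP; rewrite -(mem_point (c := b0 * c1 * u2 + b2 * c0 * u1)
    (k := u) (l := l5) repW _ bc) // Eb Ec Eu /det3 /=; ring.
have e7 : u1 * v2 * d0 + u2 * v0 * d1 - u1 * v0 * d2 = 0.
  by apply/eqP; rewrite -(mem_point (c := u1 * v2 * d0 + u2 * v0 * d1 - u1 * v0 * d2)
    (k := d) (l := kD) repW _ uv) //
    Eu Ev Ed /det3 /=; ring.
move/subr0_eq: e1 => e1; move/subr0_eq: e2 => e2; move/subr0_eq: e3 => e3.
(* Elimination of [a] and [c] through [e1], [e2], [e5]; [f6] likewise eliminates [b] and [c] through
   [e1], [e3], [e6]. *)
have f5 : v2 * d0 + v0 * d2 = 0.
  apply: (mulfI (mulf_neq0 a2n (mulf_neq0 c0n d1n))); rewrite mulr0.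
  transitivity (a2 * d1 * (c0 * v2 * d0) + a2 * v0 * d2 * (c0 * d1)); first by ring.
  by rewrite -e2 e1 -[RHS](mulr0 (- (d2 * d0))) -e5; ring.
have f6 : d1 * u2 + d2 * u1 = 0.
  apply: (mulfI (mulf_neq0 b2n (mulf_neq0 c0n d0n))); rewrite mulr0.
  transitivity (b2 * d0 * (u2 * (c0 * d1)) + b2 * c0 * u1 * d2 * d0); first by ring.
  by rewrite e3 e1 -[RHS](mulr0 (d2 * d0)) -e6; ring.
(* Under [f5] and [f6] each of the three terms of [e7], the concurrence at D, equals - u1 v0 d2. *)
apply: (mulfI (mulf_neq0 u1n (mulf_neq0 v0n d2n))); rewrite mulr0.
transitivity (u1 * (v2 * d0 + v0 * d2) + v0 * (d1 * u2 + d2 * u1)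
  - (u1 * v2 * d0 + u2 * v0 * d1 - u1 * v0 * d2)); first by ring.
by rewrite f5 f6 e7 !mulr0 addr0 subr0.
Qed.
End FourQuadruplePoints.
End Exceptional.

(** * Three quadruple points on one line *)

Section ThreeQuadruplePoints.
Variables (T I : finType) (B : I -> {set T}).
Hypothesis lsB : linear_space B.
Hypothesis T10 : #|T| = 10%N.
Hypothesis le4 : forall k, (#|B k| <= 4)%N.
Hypotheses (t4 : t_ B 4 = 3%N) (t3 : (8 <= t_ B 3)%N).

Lemma card_outside (k l n : I) : n != k -> n != l ->
  (#|B n| <= 2 + #|B n :\: (B k :|: B l)|)%N.
Proof.
move=> nk nl; rewrite -(cardsID (B k :|: B l) (B n)) leq_add2r setIUr.
apply: leq_trans (leq_card_setU _ _) _.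
exact: (leq_add (card_meet lsB nk) (card_meet lsB nl)).
Qed.

Lemma triple_points_through (S : {set T}) :
  (forall n, #|B n| = 3%N -> (0 < #|B n :&: S|)%N) -> (t_ B 3 <= \sum_(i in S) deg B 3 i)%N.
Proof.
move=> meetS; rewrite /deg double_count /t_; apply: leq_sum => n _.
case: eqP => [/meetS|//]; rewrite muln1.
by rewrite (_ : [set i in _ | _] = B n :&: S) //; apply/setP => i; rewrite !inE.
Qed.

(** Without a common line, [k] and [l] use eight lines. The other two both pass through the third
    quadruple point, so each carries at most three triple points; but every triple point lies on one
    of them, and there are at least eight. *)
Lemma three_quadruple_meet (k l : I) : #|B k| = 4%N -> #|B l| = 4%N -> k != l ->
  exists2 i, i \in B k & i \in B l.
Proof.
move=> k4 l4 kl; apply/exists_inP; apply: contraT => /exists_inPn disj.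
have kl0 : B k :&: B l = set0.
  by apply/setP => i; rewrite !inE; apply/negP => /andP[/disj/negP].
have kl8 : #|B k :|: B l| = 8%N by rewrite cardsU kl0 cards0 k4 l4.
have : #|[set n | #|B n| == 4%N] :\ k :\ l| == 1%N.
  have := cardsD1 k [set n | #|B n| == 4%N]; rewrite -card_t_ t4.
  have := cardsD1 l ([set n | #|B n| == 4%N] :\ k).
  by rewrite !inE [l == k]eq_sym kl k4 l4 /=; lia.
case/cards1P => m /setP/(_ m); rewrite !inE eqxx => /and3P[ml mk /eqP m4].
have S2 : #|~: (B k :|: B l)| = 2%N by rewrite cardsCs setCK T10 kl8.
have Sm : ~: (B k :|: B l) \subset B m.
  have /eqP <- : B m :\: (B k :|: B l) == ~: (B k :|: B l).
    rewrite eqEcard setDE subsetIr -setDE S2.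
    by have := card_outside mk ml; rewrite m4; lia.
  by rewrite setDE subsetIl.
have : (t_ B 3 <= \sum_(i in ~: (B k :|: B l)) 3)%N.
  apply: leq_trans (triple_points_through _) _; last first.
    apply: leq_sum => i /(subsetP Sm) im; have := degree_small lsB i le4; rewrite T10.
    have := @deg_ge _ _ B 4 i [:: m] isT; case/(_ _)/wrap => [n|]; last by rewrite /=; lia.
    by rewrite inE => /eqP->.
  move=> n n3; rewrite -setDE.
  have nk : n != k by apply: contra_eq_neq n3 => ->; rewrite k4.
  have nl : n != l by apply: contra_eq_neq n3 => ->; rewrite l4.
  by have := card_outside nk nl; rewrite n3; lia.
by rewrite sum_nat_const S2; lia.
Qed.

(* Otherwise at least five lines have one quadruple and three triple points, and each
   of them has a triple point on the only line [e] avoiding all quadruple points. *)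
Lemma three_quadruple_concurrent : exists i, deg B 4 i = 3%N.
Proof.
have [/existsP[i /eqP e]|/existsPn no3] := boolP [exists i, deg B 4 i == 3%N].
  by exists i.
have dsum j := degree_small lsB j le4; rewrite T10 in dsum.
have dle i : (deg B 4 i <= 2)%N by have := dsum i; have := no3 i; lia.
have sat := sum_deg_pairs lsB 4; rewrite t4 in sat.
pose W := [set i | (deg B 4 i == 1%N) && (deg B 3 i == 3%N)].
pose Z := [set i | deg B 4 i == 0%N].
have cardE' (S : {set T}) : (\sum_i (i \in S) = #|S|)%N.
  by rewrite -sum1_card [RHS]big_mkcond.
have W5 : (5 <= #|W|)%N.
  (* Without the indicator the bound fails exactly on [W], by 2. Summation gives 96 <= 86 + 2
     |W|. *)
  have : (\sum_i (2 * deg B 3 i + 4 * deg B 4 i) <=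
      \sum_i (8 * 1 + deg B 4 i * (deg B 4 i).-1 + 2 * (i \in W)))%N.
    apply: leq_sum => i _; rewrite inE; have := dsum i; have := dle i.
    by move: (deg B 2 i) (deg B 3 i) (deg B 4 i) => a [|[|[|[|b]]]] [|[|[|c]]] //=; lia.
  rewrite !big_split /= -!big_distrr /= !sum_deg t4 sum1_card T10 cardE'; lia.
have Z1 : (#|Z| <= 1)%N.
  (* Lines of [Z] are those where the bound without the indicator has slack 2; summation gives 2 |Z|
     + 24 <= 26. *)
  have : (\sum_i (2 * (i \in Z) + 2 * deg B 4 i) <=
      \sum_i (2 * 1 + deg B 4 i * (deg B 4 i).-1))%N.
    apply: leq_sum => i _; rewrite inE; have := dle i.
    by move: (deg B 4 i) => [|[|[|c]]].
  rewrite [leqRHS]big_split [leqLHS]big_split /= -!big_distrr /= sum_deg t4.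
  rewrite sum1_card T10 cardE'; lia.
have single i k l : i \in W -> i \in B k -> i \in B l -> #|B k| = 4%N -> #|B l| =
  4%N -> k = l.
  rewrite inE => /andP[/eqP i1 _] ik il k4 l4; apply/eqP; apply: contraT => kl.
  have := @deg_ge _ _ B 4 i [:: k; l]; rewrite i1 /= inE kl => /(_ isT).
  by case/(_ _)/wrap => // n; rewrite !inE => /orP[] /eqP->.
(* Let [j] join the two quadruple points off [i]. The point of [i] and [j] is triple, as [i] has no
   double point, and its third line [e] misses all quadruple points because each of them already
   lies on [i] or [j]. *)
have through i : i \in W -> exists l e j,
    [/\ i \in B l, #|B l| = 3%N, e \in Z, e \in B l & (j \in B l) && (deg B 4 j == 2%N)].
  move=> iW; have := iW; rewrite inE => /andP[/eqP i1 /eqP i3].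
  have [k ik k4] : exists2 k, i \in B k & #|B k| = 4%N by apply: deg_gt0; rewrite i1.
  have : #|[set n | #|B n| == 4%N] :\ k| == 2%N.
    by have := cardsD1 k [set n | #|B n| == 4%N]; rewrite -card_t_ t4 inE k4 /=; lia.
  case/cards2P => k1 [k2 [k12 e12]].
  have mem4 n : n != k -> (#|B n| == 4%N) = (n == k1) || (n == k2).
    by move=> nk; have /setP/(_ n) := e12; rewrite !inE nk.
  have [k1k k2k] : k1 != k /\ k2 != k.
    by have /setP e := e12; have := e k1; have := e k2; rewrite !inE !eqxx ?orbT;
      case/andP => -> _ /andP[-> _].
  have k14 : #|B k1| = 4%N by apply/eqP; rewrite mem4 ?eqxx.
  have k24 : #|B k2| = 4%N by apply/eqP; rewrite mem4 ?eqxx ?orbT.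
  have [j jk1 jk2] := three_quadruple_meet k14 k24 k12.
  have j2 : deg B 4 j = 2%N.
    have := @deg_ge _ _ B 4 j [:: k1; k2]; rewrite /= inE k12 => /(_ isT).
    case/(_ _)/wrap => [n|]; first by rewrite !inE => /orP[] /eqP->.
    by have := dle j; lia.
  have jk : j \notin B k.
    apply/negP => jk; have := @deg_ge _ _ B 4 j [:: k; k1; k2].
    rewrite /= !inE negb_or k12 ![k == _]eq_sym k1k k2k => /(_ isT).
    by case/(_ _)/wrap => [n|]; [rewrite !inE => /or3P[] /eqP->|rewrite j2].
  have ij : i != j by apply: contraNneq jk => <-.
  have [l il jl] := joining_point lsB ij.
  have d2 : deg B 2 i = 0%N by move: (dsum i) i1 i3; clear; lia.
  have l4 : #|B l| <> 4%N.
    by move=> l4; move: jk; rewrite (single i k l) ?jl.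
  have l3 : #|B l| = 3%N.
    by move: l4 (deg_eq0 d2 il) (le4 l) (sizes_gt1 lsB l); clear; lia.
  have [e Bl /andP[ei ej]] := third_line l3 ij il jl.
  have el : e \in B l by rewrite Bl !inE eqxx !orbT.
  exists l, e, j; split=> //; last by rewrite jl j2.
  rewrite inE -leqn0 leqNgt; apply/negP => /deg_gt0[n en n4].
  have ln : l != n by apply: contra_not_neq l4 => ->.
  have same m : m \in B l -> e != m -> m \notin B n.
    by move=> ml em; apply: contraNN ln => mn; apply/eqP; apply: (same_point lsB em).
  have [nk|nk] := eqVneq n k; first by have := same i il ei; rewrite nk ik.
  move/eqP: n4; rewrite mem4 // => /orP[] /eqP nn; have := same j jl ej;
    by rewrite nn ?jk1 ?jk2.
have [i0 i0W] : exists i, i \in W by apply/card_gt0P; lia.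
have [_ [e [_ [_ _ eZ _ _]]]] := through i0 i0W.
have onlye e' : e' \in Z -> e' = e by move=> e'Z; apply: (card_le1_eqP Z1).
(* Such a point contains [e] and some [j], neither in [W], hence at most one line of [W]. So deg 3
   [e] is at least 5, although nine other lines allow only 4. *)
pose g l := (e \in B l) && (#|B l| == 3%N) && [exists j in B l, deg B 4 j == 2%N].
have : (#|W| <= deg B 3 e)%N.
  rewrite -sum1_card; apply: (@leq_trans (\sum_(i in W) \sum_(l | i \in B l) g l)%N).
    apply: leq_sum => i /through[l [e' [j [il l3 /onlye-> el /andP[jl j2]]]]].
    rewrite (bigD1 l) //= /g el l3 eqxx /= (_ : [exists j in B l, _]) //.
    by apply/exists_inP; exists j.
  rewrite double_count /deg [leqRHS]big_mkcond; apply: leq_sum => l _.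
  rewrite /g; case: (boolP (e \in B l)) => el; rewrite /= ?muln0 //.
  case: eqP => l3; rewrite /= ?muln0 //.
  case: exists_inP => [[j jl /eqP j2]|]; rewrite /= ?muln0 // muln1.
  have ej : e != j by apply: contraTneq eZ => ->; rewrite inE j2.
  have [i Bl _] := third_line l3 ej el jl.
  rewrite -(cards1 i); apply: subset_leq_card; apply/subsetP => m.
  rewrite Bl !inE => /andP[/orP[/orP[]|] /eqP-> //].
    by move: eZ; rewrite inE => /eqP->.
  by rewrite j2.
by have := dsum e; lia.
Qed.

(* In coordinates adapted to the line [i0], concurrency of [a], [b], [d] reads
   [om a + om b = zeta d]; summing over the three triple points of [d] shows that
   [3 zeta d] does not depend on [d]. *)
Lemma three_quadruple_char3 (K : fieldType) (V : T -> K * K * K) :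
  represents B V -> (3%:R : K) = 0.
Proof.
move=> repV; have [i0 i03] := three_quadruple_concurrent.
have dsum j := degree_small lsB j le4; rewrite T10 in dsum.
pose Q := [set k | (i0 \in B k) && (#|B k| == 4%N)].
have Q3 : #|Q| = 3%N by rewrite -i03 /deg -sum1dep_card [LHS]big_mkcondr.
have := mem_enum Q; have := enum_uniq Q; rewrite cardE in Q3; move: Q3.
case: (enum Q) => [|k1 [|k2 [|k3 [|]]]] // _.
rewrite /= !inE negb_or => /and3P[/andP[k12 k13] k23 _] memQ.
have memk k : (i0 \in B k) && (#|B k| == 4%N) = [|| k == k1, k == k2 | k == k3].
  by have := memQ k; rewrite !inE => <-.
have [ik1 /eqP k14] : i0 \in B k1 /\ #|B k1| == 4%N by apply/andP; rewrite memk eqxx.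
have [ik2 /eqP k24] : i0 \in B k2 /\ #|B k2| == 4%N by apply/andP; rewrite memk eqxx ?orbT.
have [ik3 /eqP k34] : i0 \in B k3 /\ #|B k3| == 4%N by apply/andP; rewrite memk eqxx ?orbT.
have [d20 d30] : deg B 2 i0 = 0%N /\ deg B 3 i0 = 0%N.
  by move: (dsum i0) i03; clear; lia.
have cover i : [|| i \in B k1, i \in B k2 | i \in B k3].
  have [->|ii0] := eqVneq i i0; first by rewrite ik1.
  have [l il i0l] := joining_point lsB ii0.
  have l4 : #|B l| == 4%N.
    by move: (deg_eq0 d20 i0l) (deg_eq0 d30 i0l) (le4 l) (sizes_gt1 lsB l); clear; lia.
  by have := memk l; rewrite i0l l4 => /esym/or3P[] /eqP <-; rewrite il ?orbT.
have only k l i : k != l -> i0 \in B k -> i0 \in B l -> i != i0 -> i \in B k -> i \notin B l.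
  move=> kl i0k i0l ii0 ik; apply: contraNN kl => il; apply/eqP.
  exact: (same_point lsB ii0).
pose C3 := [set c in B k3 :\ i0 | deg B 3 c == 3%N].
(* Every triple point has a line in each of the three pencils. The three lines of the pencil [k3]
   other than [i0] carry at most two triple points each, or three if in [C3], so 8 <= 6 + |C3|. *)
have : (1 < #|C3|)%N.
  have : (t_ B 3 <= \sum_(i in B k3) deg B 3 i)%N.
    apply: triple_points_through => n n3.
    have nk k : #|B k| = 4%N -> n != k by move=> k4; apply: contra_eq_neq n3 => ->;
      rewrite k4.
    have := card_outside (nk _ k14) (nk _ k24); rewrite n3 => lt.
    apply: leq_trans (_ : #|B n :\: (B k1 :|: B k2)| <= _)%N; first by lia.
    apply: subset_leq_card; apply/subsetP => i; rewrite !inE negb_or.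
    by case/andP => /andP[i1 i2] ->; have := cover i; rewrite (negPf i1) (negPf i2).
  rewrite (big_setD1 i0) //= d30 add0n.
  have : (\sum_(i in B k3 :\ i0) deg B 3 i <=
    \sum_(i in B k3 :\ i0) (2 * 1 + (deg B 3 i == 3%N)))%N.
    apply: leq_sum => i; rewrite !inE => /andP[_ ik].
    have := @deg_ge _ _ B 4 i [:: k3] isT; case/(_ _)/wrap => [n|];
      first by rewrite inE => /eqP->.
    move: (dsum i); move: (deg B 2 i) (deg B 3 i) (deg B 4 i); clear.
    by move=> x [|[|[|[|y]]]] z /=; lia.
  rewrite big_split /= -big_distrr /= sum1_card.
  have -> : (\sum_(i in B k3 :\ i0) (deg B 3 i == 3%N) = #|C3|)%N.
    rewrite -sum1_card /C3 [RHS](eq_bigl (fun i =>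
      (i \in B k3 :\ i0) && (deg B 3 i == 3%N))).
      by rewrite [RHS]big_mkcondr.
    by move=> i; rewrite !inE.
  by move: (cardsD1 i0 (B k3)) t3; rewrite ik3 k34; clear; lia.
case/card_gt1P => c [c' [cC c'C cc']].
have other k : i0 \in B k -> #|B k| = 4%N -> exists2 i, i \in B k & i != i0.
  move=> i0k k4; have /card_gt0P[i ik] : (0 < #|B k :\ i0|)%N.
    by move: (cardsD1 i0 (B k)); rewrite i0k k4; clear; lia.
  by move: ik; rewrite !inE => /andP[ii0 ik]; exists i.
have [a0 a01 a0i] := other k1 ik1 k14.
have [b0 b02 b0i] := other k2 ik2 k24.
have k21 : k2 != k1 by rewrite eq_sym.
have [W [repW Wa Wi Wb]] := represents_basis repV a0i a01 ik1 (only _ _ _ k21 ik2 ik1 b0i b02).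
pose X i := (W i).1.1; pose Y i := (W i).1.2; pose Z i := (W i).2.
have WE i : W i = (X i, Y i, Z i) by rewrite /X /Y /Z; case: (W i) => [[]].
have b01 := only _ _ _ k21 ik2 ik1 b0i b02.
have a02 := only _ _ _ k12 ik1 ik2 a0i a01.
have a03 := only _ _ _ k13 ik1 ik3 a0i a01.
have b03 := only _ _ _ k23 ik2 ik3 b0i b02.
have i0b : i0 != b0 by rewrite eq_sym.
have Z1 i : i \in B k1 -> Z i = 0.
  move=> i1; apply/eqP; rewrite -(mem_point (c := Z i) (k := i) repW _ a0i a01 ik1) //.
  by rewrite Wa Wi WE /det3 /=; ring.
have X2 i : i \in B k2 -> X i = 0.
  move=> i2; apply/eqP; rewrite -(mem_point (c := X i) (k := i) repW _ i0b ik2 b02) //.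
  by rewrite Wb Wi WE /det3 /=; ring.
have Xn k i : i0 \in B k -> i != i0 -> i \in B k -> b0 \notin B k -> X i != 0.
  move=> i0k ii0 ik; rewrite (mem_point (c := X i) repW _ ii0 ik i0k) //.
  by rewrite Wb Wi WE /det3 /=; ring.
have Zn k i : i0 \in B k -> i != i0 -> i \in B k -> a0 \notin B k -> Z i != 0.
  move=> i0k ii0 ik; rewrite (mem_point (c := - Z i) repW _ ii0 ik i0k) ?oppr_eq0 //.
  by rewrite Wa Wi WE /det3 /=; ring.
have C3P d : d \in C3 -> [/\ d \in B k3, d != i0 & deg B 3 d = 3%N].
  by rewrite !inE => /andP[/andP[-> ->] /eqP].
have ratio d : d \in C3 -> Z d * X c = Z c * X d.
  case/C3P => d3 di0 _; have [c3 ci0 _] := C3P c cC; apply/eqP; rewrite -subr_eq0.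
  rewrite -(mem_point (c := Z d * X c - Z c * X d)
    (k := d) (l := k3) (i := c) (j := i0) repW) //.
  by rewrite (WE c) (WE d) Wi /det3 /=; ring.
have Xc d : d \in C3 -> X d != 0.
  by move=> /C3P[d3 di0 _]; apply: (Xn k3).
have Zc d : d \in C3 -> Z d != 0.
  by move=> /C3P[d3 di0 _]; apply: (Zn k3).
(* Scaled, the lines of the three pencils become (X c, [om a], 0), (0, [om b], Z c) and (X c,
   [zeta d], Z c), with determinant a nonzero multiple of om a + om b - zeta d. *)
pose om i := if i \in B k1 then X c * Y i / X i else Z c * Y i / Z i.
pose zeta d := Y d * X c / X d.
have om_pair d l a b : d \in C3 -> a \in B k1 -> b \in B k2 -> a != i0 -> b != i0 ->
    a != b -> a \in B l -> b \in B l -> d \in B l -> om a + om b = zeta d.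
  move=> dC a1 b2 ai0 bi0 ab al bl dl.
  have : det3 (W a) (W b) (W d) = 0 by apply/eqP; rewrite -(repW l).
  rewrite !WE (Z1 a) // (X2 b) // /det3 /= => e.
  rewrite /om a1 (negPf (only _ _ _ k21 ik2 ik1 bi0 b2)) /zeta.
  have Xa : X a != 0 by apply: (Xn k1).
  have Zb : Z b != 0 by apply: (Zn k2).
  have Xd := Xc d dC.
  have -> : Z c = Z d * X c / X d by rewrite (ratio d dC) mulfK.
  apply: (mulIf (mulf_neq0 Xa (mulf_neq0 Zb Xd))); apply/eqP; rewrite -subr_eq0.
  rewrite -[X in _ == X](mulr0 (X c)) -e; apply/eqP; field.
  by rewrite Xa Zb Xd.
have sum_om d : d \in C3 -> \sum_(i | i \notin B k3) om i = zeta d *+ 3.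
  move=> dC; have [d3 di0 dd3] := C3P d dC.
  have d4 l : d \in B l -> #|B l| = 4%N -> l = k3.
    move=> dl l4; apply/eqP; apply: contraT => lk.
    have := @deg_ge _ _ B 4 d [:: l; k3]; rewrite /= inE lk => /(_ isT).
    case/(_ _)/wrap => [n|]; first by rewrite !inE => /orP[] /eqP->.
    by move: (dsum d) dd3; clear; rewrite /=; lia.
  have d2 l : d \in B l -> #|B l| <> 2%N.
    apply: deg_eq0; have := @deg_ge _ _ B 4 d [:: k3] isT.
    case/(_ _)/wrap => [n|]; first by rewrite inE => /eqP->.
    by move: (dsum d) dd3; clear; rewrite /=; lia.
  have [d1 dk2] : d \notin B k1 /\ d \notin B k2.
    by split; apply: (only k3) => //; rewrite eq_sym.
  (* Each line off [k3] meets [d] in one point, so the sum is regrouped by the points on [d]: [k3]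
     contributes nothing and each triple point one [zeta d]. *)
  transitivity (\sum_(i | i \notin B k3) \sum_(l | (i \in B l) && (d \in B l)) om i).
    apply: eq_bigr => i i3; have id : i != d by apply: contraNneq i3 => ->.
    have [l il dl] := joining_point lsB id.
    rewrite (big_pred1 l) // => n /=; apply/andP/eqP => [[inn dn]|-> //].
    exact: (same_point lsB id).
  rewrite (exchange_big_dep (fun l => d \in B l)) /=; last by move=> i l _ /andP[].
  rewrite -[in RHS]dd3 /deg -sumrMnr; apply: eq_bigr => l dl.
  have [->|lk] := eqVneq l k3.
    rewrite k34 big_pred0 ?mulr0n // => i; rewrite d3 andbT.
    by case: (i \in B k3).
  have l3 : #|B l| = 3%N.
    have l4 : #|B l| <> 4%N by move=> l4; move: lk; rewrite (d4 l) ?eqxx.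
    by move: l4 (d2 l dl) (le4 l) (sizes_gt1 lsB l); clear; lia.
  rewrite l3 eqxx mulr1n.
  have : #|B l :\ d| == 2%N by move: (cardsD1 d (B l)); rewrite dl l3; clear; lia.
  case/cards2P => a [b [ab Bl]].
  have off m : m \in [set a; b] -> [/\ m != d, m \in B l, m \notin B k3 & m != i0].
    rewrite -Bl !inE => /andP[md ml]; have m3 : m \notin B k3.
      by apply: contraNN lk => m3; apply/eqP; apply: (same_point lsB md).
    by split=> //; apply: contraNneq m3 => ->.
  rewrite (eq_bigl (fun i => i \in [set a; b])); last first.
    move=> i; rewrite dl andbT; apply/andP/idP => [[i3 il]|/off[_ -> -> _] //].
    by rewrite -Bl !inE il andbT; apply: contraNneq i3 => ->.
  rewrite big_setU1 ?inE // big_set1 /=.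
  have [ad al a3 ai] := off a (set21 _ _); have [bd bl b3 bi] := off b (set22 _ _).
  have not_both k : d \notin B k -> a \in B k -> b \in B k -> False.
    by move=> dk ak bk; move: dk; rewrite (same_point lsB ab ak bk al bl) dl.
  have := cover a; have := cover b; rewrite (negPf a3) (negPf b3) !orbF.
  case/orP => [b1|b2] /orP[a1|a2].
  - by case: (not_both k1).
  - by rewrite addrC; apply: (om_pair d l); rewrite // eq_sym.
  - exact: (om_pair d l).
  - by case: (not_both k2).
(* If 3 is invertible then zeta c = zeta c', so [c] and [c'] have proportional vectors. Their
   determinant with [a0] vanishes, which puts [a0] in the pencil [k3]. *)
apply/eqP; apply: contraT => n3.
have zz : zeta c = zeta c'.
  by apply: (mulIf n3); rewrite !mulr_natr -!sum_om.
have [c3 ci0 _] := C3P c cC; have [c'3 c'i0 _] := C3P c' c'C.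
move: a03; rewrite (mem_point (c := Y c * Z c' - Z c * Y c') repW _ cc' c3 c'3).
  move/negP => []; rewrite subr_eq0; apply/eqP.
  have Y' : Y c = Y c' * X c / X c' by move: zz; rewrite /zeta mulfK ?Xc.
  have Z' : Z c = Z c' * X c / X c' by rewrite ratio // mulfK ?Xc.
  by rewrite Y' Z'; ring.
by rewrite Wa !WE /det3 /=; ring.
Qed.
End ThreeQuadruplePoints.

(** * Configurations as linear spaces *)

Section Configuration.
Variables (K : fieldType) (d : nat) (L : 'I_d -> 'rV[K]_3) (ps : seq 'rV[K]_3).
Hypotheses (confL : line_config L) (singL : singular_points_enum L ps).

Definition block (k : 'I_(size ps)) : {set 'I_d} := [set i | incident (L i) (nth 0 ps k)].

Let point_neq0 (k : 'I_(size ps)) : nth 0 ps k != 0.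
Proof. by case: singL => nz _ _ _; apply/nz/mem_nth. Qed.

Let cross_lines i j : i != j -> cross (L i) (L j) != 0.
Proof.
case: confL => L0 Lij ij; apply/eqP => /(cross_eq0 (L0 i) (L0 j)).
exact: Lij.
Qed.

Let block_cross k i j : i != j -> i \in block k -> j \in block k ->
  proj_eq (nth 0 ps k) (cross (L i) (L j)).
Proof.
rewrite !inE => ij ik jk.
exact: incident_both (cross_lines ij) (point_neq0 k) ik jk.
Qed.

Lemma block_linear_space : linear_space block.
Proof.
case: singL => _ dist mult2 complete; split=> [k|i j ij|i j k l ij ik jk il jl].
- exact/mult2/mem_nth.
- have ip : incident (L i) (cross (L i) (L j)).
    by rewrite incident_cross; apply/eqP; ring.
  have jp : incident (L j) (cross (L i) (L j)).
    by rewrite incident_cross; apply/eqP; ring.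
  have [|q qps eq_q] := complete _ (cross_lines ij).
    by apply/card_gt1P; exists i, j; rewrite !inE.
  have kps : (index q ps < size ps)%N by rewrite index_mem.
  by exists (Ordinal kps); rewrite inE /= nth_index // -(incident_proj _ eq_q).
- have [c [c0 ek]] := block_cross ij ik jk; have [c' [c'0 el]] := block_cross ij il jl.
  have proj_kl : proj_eq (nth 0 ps k) (nth 0 ps l).
    exists (c / c'); rewrite mulf_neq0 ?invr_eq0 //; split=> //.
    by rewrite ek el scalerA divfK.
  apply/val_inj; case: (ltngtP k l) => // [kl|lk].
  + by case: (dist k l); rewrite ?kl /=.
  + by case: (dist l k); rewrite ?lk /=; last exact: proj_eq_sym.
Qed.

Lemma block_represents :
  represents block (fun i => (L i 0 0, L i 0 1, L i 0 2%:R)).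
Proof.
move=> l i j k ij il jl; rewrite inE (incident_proj _ (block_cross ij il jl)).
by rewrite incident_cross /det3 /=; congr (_ == 0); ring.
Qed.

Lemma harbourne_lower (b a : nat) (h : rat) : (0 < b)%N -> bounded block b a ->
  h = ((d%:R : rat) ^+ 2 - \sum_(q <- ps) ((mult L q)%:R : rat) ^+ 2) / (size ps)%:R ->
  - (a%:R / b%:R) <= h.
Proof.
rewrite /bounded !card_ord => b0 bnd ->.
have -> : \sum_(q <- ps) ((mult L q)%:R : rat) ^+ 2 =
    (d * d.-1 + \sum_k #|block k|)%N%:R.
  have /esym := pairs_sum block_linear_space; rewrite card_ord => ->.
  rewrite -big_split natr_sum (big_nth 0) big_mkord /=; apply: eq_bigr => k _.
  by rewrite -natrX; congr (_%:R); rewrite /mult -/(block k); case: #|_| => // n; lia.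
(* With no singular point, division by zero makes the constant 0, which still satisfies the
   bound. *)
move: (\sum_k _)%N bnd => t bnd; have [->|s0] := posnP (size ps).
  by rewrite invr0 mulr0 oppr_le0 divr_ge0 ?ler0n.
rewrite -natrX lerNl -mulNr opprB ler_pdivlMr ?ltr0n // mulrAC ler_pdivrMr ?ltr0n //.
rewrite mulrBl -!natrM lerBlDr -natrD ler_nat; case: d bnd => [|d'] bnd; nia.
Qed.

End Configuration.

(** * From linear spaces to the minima *)

Lemma is_HL_lower (K : fieldType) (d : nat) (L : 'I_d -> 'rV[K]_3) (h : rat) (b a : nat) :
  (0 < b)%N ->
  (forall (I : finType) (B : I -> {set 'I_d}) (V : 'I_d -> K * K * K),
    linear_space B -> represents B V -> bounded B b a) ->
  line_config L -> is_HL L h -> - (a%:R / b%:R) <= h.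
Proof.
move=> b0 bnd confL [ps [singL hE]]; apply: (harbourne_lower confL singL b0 _ hE).
exact: bnd (block_linear_space confL singL) (block_represents confL singL).
Qed.

Lemma HL_abs_intro (d b a : nat) (K : fieldType) :
  (0 < b)%N ->
  (exists L : 'I_d -> 'rV[K]_3, line_config L /\ is_HL L (- (a%:R / b%:R))) ->
  (forall (I : finType) (B : I -> {set 'I_d}), linear_space B -> bounded B b a) ->
  HL_abs d (- (a%:R / b%:R)).
Proof.
move=> b0 ex bnd; split; first by exists K.
by move=> F L h; apply: is_HL_lower => // I B V lsB _; apply: bnd.
Qed.

Lemma HL_field_abs (K : fieldType) (d : nat) (v : rat) : HL_abs d v ->
  (exists L : 'I_d -> 'rV[K]_3, line_config L /\ is_HL L v) -> HL_field K d v.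
Proof. by move=> [_ lower] ex; split=> // L h; apply: lower. Qed.

Lemma Cfield_natr_neq0 (n : nat) : (n.+1%:R : Cfield) <> 0.
Proof. by apply/eqP; rewrite (pnatr_eq0 (Rdefinitions.R[i])). Qed.

Theorem theorem2 :
  (HL_abs 2 0 /\ HL_abs 3 (-1) /\ HL_abs 4 (-(4%:R / 3%:R)) /\ HL_abs 5 (-(3%:R / 2%:R)) /\
   HL_abs 6 (-(12%:R / 7%:R)) /\ HL_abs 7 (-2) /\ HL_abs 8 (-2) /\
   HL_abs 9 (-(9%:R / 4%:R)) /\ HL_abs 10 (-(29%:R / 12%:R))) /\
  (HL_field Cfield 2 0 /\ HL_field Cfield 3 (-1) /\ HL_field Cfield 4 (-(4%:R / 3%:R)) /\
   HL_field Cfield 5 (-(3%:R / 2%:R)) /\ HL_field Cfield 6 (-(12%:R / 7%:R)) /\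
   HL_field Cfield 7 (-(17%:R / 9%:R)) /\ HL_field Cfield 8 (-2) /\
   HL_field Cfield 9 (-(9%:R / 4%:R)) /\ HL_field Cfield 10 (-(34%:R / 15%:R))).
Proof.
have [v0 v1 v2] : [/\ - (0%:R / 1%:R) = 0 :> rat, - (1%:R / 1%:R) = - 1 :> rat
    & - (2%:R / 1%:R) = - 2 :> rat] by rewrite !divr1 oppr0.
have abs2 : HL_abs 2 0.
  rewrite -v0; apply: HL_abs_intro; rewrite ?v0 //; first exact: attained2.
  by move=> I B lsB; apply: bound2; rewrite ?card_ord.
have abs3 : HL_abs 3 (-1).
  rewrite -v1; apply: HL_abs_intro; rewrite ?v1 //; first exact: attained3.
  by move=> I B lsB; apply: bound3; rewrite ?card_ord.
have abs4 : HL_abs 4 (-(4%:R / 3%:R)).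
  apply: HL_abs_intro attained4 _ => // I B lsB.
  by apply: bound4; rewrite ?card_ord.
have abs5 : HL_abs 5 (-(3%:R / 2%:R)).
  apply: HL_abs_intro attained5 _ => // I B lsB.
  by apply: bound5; rewrite ?card_ord.
have abs6 : HL_abs 6 (-(12%:R / 7%:R)).
  apply: HL_abs_intro attained6 _ => // I B lsB.
  by apply: bound6; rewrite ?card_ord.
have abs7 : HL_abs 7 (-2).
  rewrite -v2; apply: HL_abs_intro; rewrite ?v2 //; first exact: attained7_F2.
  by move=> I B lsB; apply: bound7; rewrite ?card_ord.
have abs8 : HL_abs 8 (-2).
  rewrite -v2; apply: HL_abs_intro; rewrite ?v2 //; first exact: attained8.
  by move=> I B lsB; apply: bound8; rewrite ?card_ord.
have abs9 : HL_abs 9 (-(9%:R / 4%:R)).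
  apply: HL_abs_intro attained9 _ => // I B lsB.
  by apply: bound9; rewrite ?card_ord.
have abs10 : HL_abs 10 (-(29%:R / 12%:R)).
  apply: HL_abs_intro attained10_F3 _ => // I B lsB.
  by apply: bound10; rewrite ?card_ord.
split; first by do 8!split=> //.
split; first exact: HL_field_abs attained2.
split; first exact: HL_field_abs attained3.
split; first exact: HL_field_abs attained4.
split; first exact: HL_field_abs attained5.
split; first exact: HL_field_abs attained6.
split.
  split; first exact: attained7.
  move=> L h; apply: is_HL_lower => // I B V lsB repV.
  have [//|B3] := bound7_or_fano lsB (card_ord 7).
  (* Because of the successor in [Cfield_natr_neq0], index 1 says that 2 is nonzero; index 2 below
     concerns 3. *)
  by case: (@Cfield_natr_neq0 1); apply: fano_char2 B3 repV; rewrite ?card_ord.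
split; first exact: HL_field_abs attained8.
split; first exact: HL_field_abs attained9.
split; first exact: attained10.
move=> L h; apply: is_HL_lower => // I B V lsB repV.
have [//|[le4 exceptional]] := bound10_or_exceptional lsB (card_ord 10).
case: (@Cfield_natr_neq0 2); case: exceptional => [[t4 t3]|[t4 t3]].
  exact: (three_quadruple_char3 lsB (card_ord 10) le4 t4 t3 repV).
exact: (four_quadruple_char3 lsB (card_ord 10) le4 t4 t3 repV).
Qed.
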